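(* Let $r,s\ge1$ and let $p_1,\dots,p_r,q_1,\dots,q_s$ be positive integers with $p_1+\cdots+p_r=q_1+\cdots+q_s$ and $\gcd(p_1,\dots,p_r,q_1,\dots,q_s)=1$. Let $q$ be a prime power whose characteristic divides none of the $p_i,q_j$, and let $\lambda\in\mathbb{F}_q^\times$. Then $$|V_\lambda(\mathbb{F}_q^\times)|+\sum_{C}N_{C,\lambda}=P_{rs}(q)+(-1)^{r+s-1}q^{\min(r-1,s-1)}H_q(M\lambda),$$ where the sum runs over all non-empty cells $C$ with $|S(C)|\le r+s-2$, and $$P_{rs}(q)=\sum_{m=0}^{\min(r-1,s-1)}\binom{r-1}{m}\binom{s-1}{m}\frac{q^{r+s-m-2}-q^m}{q-1}.$$
   Context: Fix a nontrivial additive character $\psi_q$ of $\mathbb{F}_q$ and a generator $\omega$ of the group of multiplicative characters of $\mathbb{F}_q^\times$. For $m\in\mathbb{Z}$ put $g(m)=\sum_{x\in\mathbb{F}_q^\times}\omega(x)^m\psi_q(x)$ (a Gauss sum; it is periodic in $m$ with period $q-1$). Put $M=\prod_i p_i^{p_i}/\prod_j q_j^{q_j}$ (viewed in $\mathbb{F}_q^\times$) and $\epsilon=(-1)^{q_1+\cdots+q_s}$. For $m\in\mathbb{Z}$ let $s(m)=\min\big(\#\{i: p_im\equiv0 \bmod (q-1)\},\#\{j:q_jm\equiv0\bmod (q-1)\}\big)$ (equivalently, the multiplicity of $e^{2\pi i m/(q-1)}$ as a root of $\gcd(\prod_i(X^{p_i}-1),\prod_j(X^{q_j}-1))$). For $t\in\mathbb{F}_q^\times$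 define $$H_q(t)=\frac{(-1)^{r+s}}{1-q}\sum_{m=0}^{q-2}q^{s(m)-s(0)}\prod_{i=1}^r g(p_im)\prod_{j=1}^s g(-q_jm)\,\omega(\epsilon M^{-1}t)^m .$$ $V_\lambda(\mathbb{F}_q^\times)$ is the set of points $(x_1:\dots:x_r:y_1:\dots:y_s)\in\mathbb{P}^{r+s-1}(\mathbb{F}_q)$ with all coordinates nonzero satisfying $x_1+\cdots+x_r=y_1+\cdots+y_s$ and $\lambda x_1^{p_1}\cdots x_r^{p_r}=y_1^{q_1}\cdots y_s^{q_s}$. A cell is a finite (possibly empty) sequence of distinct pairs $(i_1,j_1),\dots,(i_l,j_l)$ with $1\le i_k\le r$, $1\le j_k\le s$, $i_1\le\cdots\le i_l$ and $j_1\le\cdots\le j_l$; $l=l(C)$ is its length, $S_x(C)=\{i_1,\dots,i_l\}$, $S_y(C)=\{j_1,\dots,j_l\}$, and $|S(C)|=|S_x(C)|+|S_y(C)|$. For a cell put $a_{S}=\gcd(\{p_i:i\in S_x(C)\}\cup\{q_j:j\in S_y(C)\})$. For a non-empty cell with $|S(C)|\le r+s-1$, let $N'_{C,\lambda}$ be the number of tuples $(x_i)_{i\notin S_x(C)},(y_j)_{j\notin S_y(C)},z$ with all entries in $\mathbb{F}_q^\times$, one chosen coordinate among the $x_i$ ($i\notin S_x$) or $y_j$ ($j\notin S_y$) fixed equal to $1$, satisfying $\sum_{i\notin S_x}x_i=\sum_{j\notin S_y}y_j$ and $\lambda z^{a_S}\prod_{i\notin S_x}x_i^{p_i}=\prod_{j\notin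 S_y}y_j^{q_j}$; and put $N_{C,\lambda}=(q-1)^{|S(C)|-l(C)-1}N'_{C,\lambda}$ (this is the number of points of the boundary component $W_{C,\lambda}$ of the paper's toric completion of $V_\lambda$). *)

(* Defs.v *)
From HB Require Import structures.
From mathcomp Require Import all_boot all_order all_algebra all_field.
Set Implicit Arguments. Unset Strict Implicit. Unset Printing Implicit Defensive.
Import Order.TTheory GRing.Theory Num.Theory.
Local Open Scope ring_scope.

Section Defs.
Variable F : finFieldType.

Definition is_add_char (psi : F -> algC) : Prop :=
  psi 0 = 1 /\ (forall x y, psi (x + y) = psi x * psi y).
Definition nontrivial_add_char (psi : F -> algC) : Prop :=
  is_add_char psi /\ exists x, psi x != 1.

(* multiplicative character of F^x (values at 0 irrelevant) *)
Definition is_mult_char (w : F -> algC) : Prop :=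
  w 1 = 1 /\ (forall x y, x != 0 -> y != 0 -> w (x * y) = w x * w y).
(* generator of the (cyclic, order q-1) group of multiplicative characters:
   its order in that group is exactly q-1 *)
Definition is_char_generator (w : F -> algC) : Prop :=
  is_mult_char w /\
  (forall k : nat, (forall x, x != 0 -> w x ^+ k = 1) -> (#|F|.-1 %| k)%N).

Definition gauss (psi w : F -> algC) (m : int) : algC :=
  \sum_(x : F | x != 0) w x ^ m * psi x.

Variables (r s : nat) (p : 'I_r -> nat) (q : 'I_s -> nat).

Definition sfun (m : nat) : nat :=
  minn #|[set i : 'I_r | (p i * m %% #|F|.-1 == 0)%N]|
       #|[set j : 'I_s | (q j * m %% #|F|.-1 == 0)%N]|.

Definition Mconst : F :=
  (\prod_(i < r) (p i)%:R ^+ p i) / (\prod_(j < s) (q j)%:R ^+ q j).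
Definition epsF : F := (-1) ^+ (\sum_(j < s) q j).

Definition Hq (psi w : F -> algC) (t : F) : algC :=
  (-1) ^+ (r + s) / (1 - #|F|%:R) *
  \sum_(m < #|F|.-1)
     ((#|F|%:R : algC) ^ ((sfun m)%:Z - (sfun 0)%:Z) *
      (\prod_(i < r) gauss psi w ((p i * m)%N)%:Z) *
      (\prod_(j < s) gauss psi w (- ((q j * m)%N)%:Z)) *
      w (epsF / Mconst * t) ^+ m).

(* |V_lambda(F^x)|: projective points with nonzero coordinates, counted via
   their unique representative with x_1 = 1 *)
Definition Vcount (lam : F) : nat :=
  #|[set xy : {ffun 'I_r -> F} * {ffun 'I_s -> F} |
     [&& [forall i, xy.1 i != 0], [forall j, xy.2 j != 0],
         [forall i : 'I_r, (val i == 0)%N ==> (xy.1 i == 1)],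
         \sum_(i < r) xy.1 i == \sum_(j < s) xy.2 j &
         lam * \prod_(i < r) xy.1 i ^+ p i == \prod_(j < s) xy.2 j ^+ q j]]|.

Definition is_cell (c : seq ('I_r * 'I_s)) : bool :=
  uniq c && sorted (fun a b : 'I_r * 'I_s => (a.1 <= b.1)%N && (a.2 <= b.2)%N) c.
Definition Sx (c : seq ('I_r * 'I_s)) : {set 'I_r} := [set a.1 | a in c].
Definition Sy (c : seq ('I_r * 'I_s)) : {set 'I_s} := [set a.2 | a in c].
Definition aS (c : seq ('I_r * 'I_s)) : nat :=
  gcdn (\big[gcdn/0%N]_(i in Sx c) p i) (\big[gcdn/0%N]_(j in Sy c) q j).

(* N'_{C,lambda}: coordinates indexed by S_x(C) (resp. S_y(C)) are absent;
   they are encoded as fixed to 0. The chosen coordinate fixed to 1 is the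
   first x_i with i notin S_x, or else the first y_j with j notin S_y. *)
Definition Nprime (lam : F) (c : seq ('I_r * 'I_s)) : nat :=
  #|[set t : {ffun 'I_r -> F} * {ffun 'I_s -> F} * F |
     [&& [forall i, if i \in Sx c then t.1.1 i == 0 else t.1.1 i != 0],
         [forall j, if j \in Sy c then t.1.2 j == 0 else t.1.2 j != 0],
         t.2 != 0,
         match [pick i | i \notin Sx c] with
         | Some i0 => t.1.1 i0 == 1
         | None => if [pick j | j \notin Sy c] is Some j0 then t.1.2 j0 == 1
                   else true
         end,
         \sum_(i | i \notin Sx c) t.1.1 i == \sum_(j | j \notin Sy c) t.1.2 j &
         lam * t.2 ^+ aS c * \prod_(i | i \notin Sx c) t.1.1 i ^+ p i
           == \prod_(j | j \notin Sy c) t.1.2 j ^+ q j]]|.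

Definition Ncell (lam : F) (c : seq ('I_r * 'I_s)) : nat :=
  (#|F|.-1 ^ (#|Sx c| + #|Sy c| - size c - 1) * Nprime lam c)%N.

End Defs.

Definition Prs (r s : nat) (Q : algC) : algC :=
  \sum_(m < (minn (r - 1) (s - 1)).+1)
     ('C(r - 1, m) * 'C(s - 1, m))%:R * ((Q ^+ (r + s - m - 2) - Q ^+ m) / (Q - 1)).

(* Main.v *)
Require Import Defs.
From HB Require Import structures.
From mathcomp Require Import all_boot all_order all_algebra all_field all_fingroup all_solvable.
From mathcomp Require Import ring zify.
Import Order.TTheory GRing.Theory Num.Theory.
Local Open Scope ring_scope.
Set Implicit Arguments. Unset Strict Implicit. Unset Printing Implicit Defensive.

(** Write Q = |F| and X = Q - 1. Detecting the equations of V and of each N'_C by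
additive and multiplicative characters expresses every count through one and the
same family of terms
  G(m) = omega(epsilon lambda)^m prod_i g(p_i m) prod_j g(-q_j m),
where a cell C only retains those m for which p_i m = q_j m = 0 mod X on its
support (there g = -1). V is the contribution of the empty cell. The same
expression vanishes for the cells with |S(C)| = r + s - 1 and is
X^(r+s-l-2) for those with |S(C)| = r + s, so one may sum over all cells and
subtract the latter.

A cell is a chain of the product order on [r] x [s]. Weighted sums over the chains
inside a box [a] x [b] satisfy a recursion in (a, b). With weight -X for every row
and column in I and J and 1/X for every pair, the sum is Q^min(|I|, |J|), which is
the power of Q in H_q; with trivial weights, or restricted to full support, it is
a Delannoy polynomial, and the two of them make up P_rs. *)

(** * Sums over chains *)

Section Delannoy.
Variable R : fieldType.
Implicit Types y : R.

(** Generating polynomial of the lattice paths from (0, 0) to (a, b) with steps (1, 0), (0, 1) and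
    (1, 1), a diagonal step weighing y - 1; y = 2 gives the Delannoy numbers. *)
Definition delannoy y (a b : nat) : R :=
  \sum_(m < a.+1) ('C(a, m) * 'C(b, m))%:R * y ^+ m.

(** Terms beyond min(a, b) contain a zero binomial coefficient. This gives symmetry in a and b and
    allows the summation range of [Prs]. *)
Lemma delannoy_widen y a b n : (minn a b <= n)%N ->
  \sum_(m < n.+1) ('C(a, m) * 'C(b, m))%:R * y ^+ m = delannoy y a b.
Proof.
suff H k : (minn a b <= k)%N -> \sum_(m < k.+1) ('C(a, m) * 'C(b, m))%:R * y ^+ m
    = \sum_(m < (minn a b).+1) ('C(a, m) * 'C(b, m))%:R * y ^+ m.
  by move=> le; rewrite /delannoy (H n le) (H a (geq_minl _ _)).
move=> le; rewrite [RHS](big_ord_widen k.+1 (fun m => ('C(a, m) * 'C(b, m))%:R * y ^+ m)) //.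
rewrite [RHS]big_mkcond.
apply: eq_bigr => m _; case: ltnP => // lt.
have : (a < m)%N || (b < m)%N by lia.
by case/orP => h; rewrite (bin_small h) ?muln0 mul0r.
Qed.

Lemma delannoy0n y b : delannoy y 0 b = 1.
Proof. by rewrite /delannoy big_ord1 !bin0 mul1r. Qed.

Lemma delannoyn0 y a : delannoy y a 0 = 1.
Proof. by rewrite -(@delannoy_widen _ _ _ 0) ?minn0 // big_ord1 !bin0 mul1r. Qed.

(** Pascal's rule in each degree: with C(a+1, m+1) = c + c' and C(b+1, m+1) = d + d', one has (c +
    c')(d + d') = (c + c')d' + c'(d + d') + cd - c'd'. *)
Lemma delannoySS y a b :
  delannoy y a.+1 b.+1 = delannoy y a.+1 b + delannoy y a b.+1 + (y - 1) * delannoy y a b.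
Proof.
(* The constant term is split off so that the remaining sums line up with [y * delannoy y a b],
   whose index is shifted by one. *)
have head k l : (minn k l <= a.+1)%N -> delannoy y k l =
    1 + \sum_(m < a.+1) ('C(k, m.+1) * 'C(l, m.+1))%:R * y ^+ m.+1.
  by move=> /delannoy_widen <-; rewrite big_ord_recl !bin0 mul1r.
have -> : (y - 1) * delannoy y a b = y * delannoy y a b - delannoy y a b by ring.
rewrite [X in _ = _ + (_ - X)]head; last by lia.
rewrite (head a.+1 b.+1) 1?(head a.+1 b) 1?(head a b.+1); try lia.
rewrite /delannoy mulr_sumr.
set s1 := \sum_(m < _) _; set s2 := \sum_(m < _) _; set s3 := \sum_(m < _) _.
set s4 := \sum_(m < _) _; set s5 := \sum_(m < _) _.
suff -> : s1 = s2 + s3 + s4 - s5 by ring.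
rewrite -!big_split -sumrB /=; apply: eq_bigr => m _.
by rewrite !binS !natrM !natrD exprS; ring.
Qed.

End Delannoy.

(** * Chains of the product order and the recursion for their weighted sums *)

Section ChainSets.
Variables (r s : nat).
Implicit Types (S : {set 'I_r * 'I_s}).

Definition le2 (a b : 'I_r * 'I_s) : bool := (a.1 <= b.1)%N && (a.2 <= b.2)%N.
Definition chain S := [forall a in S, forall b in S, le2 a b || le2 b a].
Definition rows S : {set 'I_r} := [set a.1 | a in S].
Definition cols S : {set 'I_s} := [set a.2 | a in S].
Definition box (a b : nat) S := [forall x in S, (x.1 < a)%N && (x.2 < b)%N].

Lemma chainP S :
  reflect {in S &, forall a b, le2 a b || le2 b a} (chain S).
Proof.
apply: (iffP forall_inP) => [h a b aS bS | h a aS].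
  by move/forall_inP: (h a aS); apply.
by apply/forall_inP => b bS; apply: h.
Qed.

Lemma rowsP S i : reflect (exists j, (i, j) \in S) (i \in rows S).
Proof.
apply: (iffP imsetP) => [[[i' j] xS ->]|[j ijS]]; first by exists j.
by exists (i, j).
Qed.

Lemma colsP S j : reflect (exists i, (i, j) \in S) (j \in cols S).
Proof.
apply: (iffP imsetP) => [[[i j'] xS ->]|[i ijS]]; first by exists i.
by exists (i, j).
Qed.

Lemma box_boxSrow S (i : 'I_r) b : box i b S = box i.+1 b S && (i \notin rows S).
Proof.
apply/forall_inP/andP => [h|[/forall_inP h ni] [x y] xyS].
  split; first by apply/forall_inP => x /h /andP[? ->]; rewrite andbT ltnS ltnW.
  by apply/rowsP => -[j /h /=]; rewrite ltnn.
have /andP[/= xi ->] := h _ xyS; rewrite andbT ltn_neqAle -ltnS xi andbT.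
apply: contra ni => /eqP/val_inj <-; apply/rowsP; by exists y.
Qed.

Lemma box_boxScol S a (j : 'I_s) : box a j S = box a j.+1 S && (j \notin cols S).
Proof.
apply/forall_inP/andP => [h|[/forall_inP h ni] [x y] xyS].
  split; first by apply/forall_inP => x /h /andP[-> ?]; rewrite /= ltnS ltnW.
  by apply/colsP => -[i /h /=]; rewrite ltnn andbF.
have /andP[/= -> yj] := h _ xyS; rewrite /= ltn_neqAle -ltnS yj andbT.
apply: contra ni => /eqP/val_inj <-; apply/colsP; by exists x.
Qed.

(** If S contains (i, j') and (i', j), the box gives j' <= j and i' <= i, so comparability of the
    two pairs forces i' = i or j' = j. *)
Lemma chain_corner S (i : 'I_r) (j : 'I_s) :
  chain S -> box i.+1 j.+1 S ->
  (i \in rows S) && (j \in cols S) = ((i, j) \in S).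
Proof.
move=> /chainP cS /forall_inP bS; apply/andP/idP => [[]|ijS]; last first.
  by split; [apply/rowsP; exists j | apply/colsP; exists i].
move=> /rowsP[j' ij'S] /colsP[i' i'jS].
have /andP[/= _] := bS _ ij'S; have /andP[/= + _] := bS _ i'jS.
rewrite !ltnS => i'i j'j.
case/orP: (cS _ _ ij'S i'jS) => /andP[/= h1 h2].
  by have -> // : i = i'; apply/val_inj/eqP; rewrite eqn_leq h1 i'i.
by have -> // : j = j'; apply/val_inj/eqP; rewrite eqn_leq h2 j'j.
Qed.

(** The pair (i, j) is the maximum of the box, hence comparable with all of S. *)
Lemma chainU1 S (i : 'I_r) (j : 'I_s) :
  box i.+1 j.+1 S -> chain ((i, j) |: S) = chain S.
Proof.
move=> /forall_inP bS.
have le_ij x : x \in S -> le2 x (i, j) by move=> /bS; rewrite !ltnS.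
apply/chainP/chainP => cS a b.
  by move=> aS bS'; apply: cS; rewrite inE ?aS ?bS' orbT.
case/setU1P=> [->|aS] /setU1P[->|bS']; rewrite ?(le_ij _ aS) ?(le_ij _ bS') ?orbT //.
  by rewrite /le2 !leqnn.
exact: cS.
Qed.

Lemma boxU1 S (i : 'I_r) (j : 'I_s) :
  box i.+1 j.+1 ((i, j) |: S) = box i.+1 j.+1 S.
Proof.
apply/forall_inP/forall_inP => h x; first by move=> xS; apply: h; rewrite inE xS orbT.
by case/setU1P => [->|/h //]; rewrite /= !ltnS !leqnn.
Qed.

Lemma rowsU1 S i j : rows ((i, j) |: S) = i |: rows S.
Proof. by rewrite /rows imsetU1. Qed.

Lemma colsU1 S i j : cols ((i, j) |: S) = j |: cols S.
Proof. by rewrite /cols imsetU1. Qed.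

(** Phrased as the round-trip condition that [reindex_onto] produces when a corner is added and
    removed again. *)
Lemma setU1_notin (T : finType) (x : T) (A : {set T}) :
  (x \notin A) = ((x |: A) :\ x == A).
Proof. by apply/idP/eqP => [xA|<-]; [rewrite setU1K | rewrite setD11]. Qed.

Section Weights.
Variables (R : fieldType) (X : R) (u u' : 'I_r -> R) (v v' : 'I_s -> R).

(** [u] weighs the rows that are met, [u'] those that are missed; only rows below a count, so the
    weight grows with the box. *)
Definition row_weight a (A : {set 'I_r}) : R :=
  \prod_(i < r | (i < a)%N) (if i \in A then u i else u' i).
Definition col_weight b (B : {set 'I_s}) : R :=
  \prod_(j < s | (j < b)%N) (if j \in B then v j else v' j).
Definition weight a b S : R :=
  X ^- #|S| * row_weight a (rows S) * col_weight b (cols S).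
Definition chain_sum a b : R := \sum_(S | chain S && box a b S) weight a b S.

Lemma row_weightS (i : 'I_r) A :
  row_weight i.+1 A = (if i \in A then u i else u' i) * row_weight i A.
Proof.
rewrite /row_weight (bigD1 i) //=; congr (_ * _).
by apply: eq_bigl => k; rewrite ltnS ltn_neqAle andbC.
Qed.

Lemma col_weightS (j : 'I_s) B :
  col_weight j.+1 B = (if j \in B then v j else v' j) * col_weight j B.
Proof.
rewrite /col_weight (bigD1 j) //=; congr (_ * _).
by apply: eq_bigl => k; rewrite ltnS ltn_neqAle andbC.
Qed.

Lemma row_weightU1 (i : 'I_r) A : row_weight i (i |: A) = row_weight i A.
Proof.
apply: eq_bigr => k ki; rewrite in_setU1; case: eqP => // e.
by rewrite e ltnn in ki.
Qed.

Lemma col_weightU1 (j : 'I_s) B : col_weight j (j |: B) = col_weight j B.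
Proof.
apply: eq_bigr => k ki; rewrite in_setU1; case: eqP => // e.
by rewrite e ltnn in ki.
Qed.

Lemma chain_sum_row0 b : chain_sum 0 b = \prod_(j < s | (j < b)%N) v' j.
Proof.
rewrite /chain_sum (big_pred1 set0) => [|S].
  rewrite /weight /row_weight /col_weight cards0 expr0 invr1 mul1r.
  rewrite big_pred0 ?mul1r => [|i]; last by rewrite ltn0.
  by apply: eq_bigr => j _; rewrite /cols imset0 inE.
rewrite /= eqEsubset sub0set andbT; apply/andP/subsetP => [[_ /forall_inP h] x /h //|h].
split; last by apply/forall_inP => x /h; rewrite inE.
by apply/chainP => a ? /h; rewrite inE.
Qed.

Lemma chain_sum_col0 a : chain_sum a 0 = \prod_(i < r | (i < a)%N) u' i.
Proof.
rewrite /chain_sum (big_pred1 set0) => [|S].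
  rewrite /weight /row_weight /col_weight cards0 expr0 invr1 mul1r.
  rewrite [X in _ * X]big_pred0 ?mulr1 => [|i]; last by rewrite ltn0.
  by apply: eq_bigr => j _; rewrite /rows imset0 inE.
rewrite /= eqEsubset sub0set andbT; apply/andP/subsetP => [[_ /forall_inP h] x /h|h].
  by rewrite ltn0 andbF.
split; last by apply/forall_inP => x /h; rewrite inE.
by apply/chainP => ? b /h; rewrite inE.
Qed.

(* The four classes of chains below (i, j), according to whether they meet
   row i and column j; a chain meeting both contains (i, j), and removing that
   corner leaves a chain of one of the three other classes. *)
Lemma chain_sumSS (i : 'I_r) (j : 'I_s) :
  chain_sum i.+1 j.+1 =
    u' i * v' j * chain_sum i j
    + v' j * (chain_sum i.+1 j - u' i * chain_sum i j)
    + u' i * (chain_sum i j.+1 - v' j * chain_sum i j)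
    + X^-1 * (u i * v j * chain_sum i j
              + v j * (chain_sum i.+1 j - u' i * chain_sum i j)
              + u i * (chain_sum i j.+1 - v' j * chain_sum i j)).
Proof.
pose cls (x y : bool) S :=
  [&& chain S && box i.+1 j.+1 S, (i \in rows S) == x & (j \in cols S) == y].
(* [weight i j] omits the factors of row i and column j; these are constant on each class and are
   put back as scalars. *)
pose part x y := \sum_(S | cls x y S) weight i j S.
have eN : chain_sum i j = part false false.
  by apply: eq_bigl => S; rewrite box_boxSrow box_boxScol /cls !eqbF_neg -!andbA;
    do !bool_congr.
have eR : chain_sum i.+1 j = u i * part true false + u' i * part false false.
  rewrite /chain_sum (bigID (fun S => i \in rows S)) !mulr_sumr /=; congr (_ + _).
    apply: eq_big => S; first by rewrite box_boxScol /cls eqb_id eqbF_neg -!andbA;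
      do !bool_congr.
    by rewrite /weight row_weightS => /andP[_ ->]; rewrite !mulrA [u i * _]mulrC.
  apply: eq_big => S; first by rewrite box_boxScol /cls !eqbF_neg -!andbA;
    do !bool_congr.
  by rewrite /weight row_weightS => /andP[_ /negPf->]; rewrite !mulrA [u' i * _]mulrC.
have eC : chain_sum i j.+1 = v j * part false true + v' j * part false false.
  rewrite /chain_sum (bigID (fun S => j \in cols S)) !mulr_sumr /=; congr (_ + _).
    apply: eq_big => S; first by rewrite box_boxSrow /cls eqb_id eqbF_neg -!andbA;
      do !bool_congr.
    by rewrite /weight col_weightS => /andP[_ ->]; rewrite mulrCA.
  apply: eq_big => S; first by rewrite box_boxSrow /cls !eqbF_neg -!andbA;
    do !bool_congr.
  by rewrite /weight col_weightS => /andP[_ /negPf->]; rewrite mulrCA.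
have eB : part true true =
    X^-1 * (part false false + part true false + part false true).
  (* Adding (i, j) is a bijection from the chains without it; the extra pair costs X^-1 and leaves
     the truncated row and column weights unchanged. *)
  rewrite {1}/part (reindex_onto (setU [set (i, j)]) (fun S => S :\ (i, j))) /=;
    last first.
    move=> S /and3P[/andP[cS bS] /eqP iS /eqP jS].
    by rewrite setD1K // -(chain_corner cS bS) iS jS.
  transitivity (\sum_(S | chain S && box i.+1 j.+1 S && ((i, j) \notin S))
                  X^-1 * weight i j S).
    apply: eq_big => S.
      rewrite /cls boxU1 rowsU1 colsU1 !setU11 !andbT.
      case bS: (box i.+1 j.+1 S); rewrite ?andbF //= chainU1 // andbT.
      by rewrite -setU1_notin.
    rewrite -setU1_notin => /andP[_ ijS].
    rewrite /weight cardsU1 ijS add1n exprS invfM rowsU1 colsU1.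
    by rewrite row_weightU1 col_weightU1 !mulrA.
  pose out S := chain S && box i.+1 j.+1 S.
  have -> : \sum_(S | chain S && box i.+1 j.+1 S && ((i, j) \notin S)) X^-1 * weight i j S
     = \sum_(S | out S && ~~ ((i \in rows S) && (j \in cols S))) X^-1 * weight i j S.
    apply: eq_bigl => S; rewrite /out; case h: (chain S && box i.+1 j.+1 S) => //=.
    by case/andP: h => h1 h2; rewrite chain_corner.
  rewrite -mulr_sumr; congr (_ * _).
  rewrite (bigID (fun S => i \in rows S)) /= addrC.
  rewrite (bigID (fun S => j \in cols S)) /= [X in X + _]addrC addrAC.
  congr (_ + _ + _); apply: eq_bigl => S; rewrite /cls /out ?eqb_id ?eqbF_neg;
  by case: (i \in _); case: (j \in _); rewrite ?andbT ?andbF.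
have -> : chain_sum i.+1 j.+1 = u i * v j * part true true + u i * v' j * part true false
   + u' i * v j * part false true + u' i * v' j * part false false.
  have part_sum (x y : bool) : \sum_(S | cls x y S) weight i.+1 j.+1 S =
      (if x then u i else u' i) * (if y then v j else v' j) * part x y.
    rewrite mulr_sumr; apply: eq_bigr => S /and3P[_ /eqP iS /eqP jS].
    by rewrite /weight row_weightS col_weightS iS jS; ring.
  rewrite -(part_sum true true) -(part_sum true false).
  rewrite -(part_sum false true) -(part_sum false false) -addrA.
  rewrite /chain_sum (bigID (fun S => i \in rows S)) /=.
  congr (_ + _); rewrite (bigID (fun S => j \in cols S)) /=; congr (_ + _);
  by apply: eq_bigl => S; rewrite /cls ?eqb_id ?eqbF_neg !andbA.
rewrite eB eN eR eC; ring.
Qed.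

End Weights.

(** * Three evaluations of the weighted chain sum *)

Section Evaluations.
Variables (R : fieldType) (X : R).
Hypothesis X_neq0 : X != 0.

Definition prefix_card n (A : {set 'I_n}) a := #|[set i in A | (i < a)%N]|.

Lemma prefix_card0 n (A : {set 'I_n}) : prefix_card A 0 = 0%N.
Proof. by apply/eqP; rewrite cards_eq0; apply/eqP/setP => i; rewrite !inE andbF. Qed.

Lemma prefix_cardS n (A : {set 'I_n}) (i : 'I_n) :
  prefix_card A i.+1 = ((i \in A) + prefix_card A i)%N.
Proof.
rewrite /prefix_card (cardsD1 i) !inE ltnS leqnn andbT; congr (_ + _)%N.
by apply: eq_card => k; rewrite !inE ltnS ltn_neqAle andbCA.
Qed.

Lemma prefix_card_full n (A : {set 'I_n}) : prefix_card A n = #|A|.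
Proof. by apply: eq_card => k; rewrite !inE ltn_ord andbT. Qed.

Lemma chain_sum_signed (I : {set 'I_r}) (J : {set 'I_s}) a b :
  (a <= r)%N -> (b <= s)%N ->
  chain_sum X (fun i => if i \in I then - X else 0) (fun=> 1)
              (fun j => if j \in J then - X else 0) (fun=> 1) a b
  = (X + 1) ^+ minn (prefix_card I a) (prefix_card J b).
Proof.
elim: a b => [|a IHa] b ar bs.
  by rewrite chain_sum_row0 prefix_card0 min0n expr0 big1.
elim: b bs => [|b IHb] bs.
  by rewrite chain_sum_col0 prefix_card0 minn0 expr0 big1.
rewrite (chain_sumSS _ _ _ _ _ (Ordinal ar) (Ordinal bs)) /=.
rewrite IHb ?(ltnW bs) // !IHa ?(ltnW ar) ?(ltnW bs) //.
rewrite -[in prefix_card I a.+1]/(Ordinal ar : nat) prefix_cardS /=.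
rewrite -[in prefix_card J b.+1]/(Ordinal bs : nat) prefix_cardS /=.
case: (Ordinal ar \in I); case: (Ordinal bs \in J); rewrite ?add0n ?add1n.
- by rewrite minnSS exprS; field.
- by ring.
- by ring.
- by ring.
Qed.

(** A chain meeting every row and column is a lattice path from corner to corner. It has a + b + 1
    pairs less one for each diagonal step, so after normalisation a diagonal step weighs X. *)
Lemma chain_sum_full a b : (a < r)%N -> (b < s)%N ->
  X ^+ (a + b).+1 * chain_sum X (fun=> 1) (fun=> 0) (fun=> 1) (fun=> 0) a.+1 b.+1
  = delannoy (X + 1) a b.
Proof.
pose T := chain_sum X (fun=> 1) (fun=> 0) (fun=> 1) (fun=> 0).
have Tn0 k : (0 < k <= r)%N -> T k 0 = 0.
  by case: k => [//|k] kr; rewrite /T chain_sum_col0 (bigD1 (Ordinal kr)) //= mul0r.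
have T0n k : (0 < k <= s)%N -> T 0 k = 0.
  by case: k => [//|k] kr; rewrite /T chain_sum_row0 (bigD1 (Ordinal kr)) //= mul0r.
have T00 : T 0%N 0%N = 1 by rewrite /T chain_sum_col0 big_pred0.
have rec k l : (k < r)%N -> (l < s)%N ->
    T k.+1 l.+1 = X^-1 * (T k l + T k.+1 l + T k l.+1).
  move=> kr ls; rewrite /T (chain_sumSS _ _ _ _ _ (Ordinal kr) (Ordinal ls)) /=.
  by ring.
rewrite -/(T a.+1 b.+1).
elim: a b => [|a IHa] b ar bs.
  elim: b bs => [|b IHb] bs.
    by rewrite delannoy0n rec // T00 Tn0 // T0n // !addr0 expr1 mulr1 divff.
  have := IHb (ltnW bs); rewrite !delannoy0n => IH.
  rewrite rec // !(T0n _ _) ?(ltnW bs) // add0r addr0.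
  by rewrite -[RHS]IH exprS; field.
elim: b bs => [|b IHb] bs.
  rewrite delannoyn0 rec // !(Tn0 _ _) ?(ltnW ar) // !add0r.
  by rewrite -(delannoyn0 (X + 1) a) -[RHS]IHa ?(ltnW ar) // !addn0 exprS; field.
rewrite delannoySS -IHb ?(ltnW bs) // -!IHa ?(ltnW bs) ?(ltnW ar) // rec //.
by rewrite !addnS !addSn !exprS; field.
Qed.

(** The corner may be added to any chain without it, whence a factor (X + 1) / X; the chains without
    it miss the last row or the last column and are counted by inclusion-exclusion. After
    normalisation the diagonal weight is (X + 1)^-1 - 1 = - X / (X + 1). *)
Lemma chain_sum_all a b : (a < r)%N -> (b < s)%N -> X + 1 != 0 ->
  X ^+ (a + b).+1 * chain_sum X (fun=> 1) (fun=> 1) (fun=> 1) (fun=> 1) a.+1 b.+1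
  = (X + 1) ^+ (a + b).+1 * delannoy (X + 1)^-1 a b.
Proof.
move=> + + Q_neq0.
pose T := chain_sum X (fun=> 1) (fun=> 1) (fun=> 1) (fun=> 1).
have Tn0 k : T k 0 = 1 by rewrite /T chain_sum_col0 big1.
have T0n k : T 0 k = 1 by rewrite /T chain_sum_row0 big1.
have rec k l : (k < r)%N -> (l < s)%N ->
    T k.+1 l.+1 = (X + 1) / X * (T k.+1 l + T k l.+1 - T k l).
  move=> kr ls; rewrite /T (chain_sumSS _ _ _ _ _ (Ordinal kr) (Ordinal ls)) /=.
  by field.
rewrite -/(T a.+1 b.+1).
elim: a b => [|a IHa] b ar bs.
  elim: b bs => [|b IHb] bs.
    by rewrite delannoy0n rec // !Tn0 !T0n; field.
  have := IHb (ltnW bs); rewrite !delannoy0n !mulr1 => IH.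
  by rewrite rec // !T0n addrK [in RHS]exprS -IH exprS; field.
elim: b bs => [|b IHb] bs.
  have := IHa 0%N (ltnW ar) bs; rewrite !delannoyn0 !mulr1 !addn0 => IH.
  by rewrite rec // !Tn0 [1 + _]addrC addrK [in RHS]exprS -IH exprS; field.
rewrite delannoySS rec //.
have IH1 := IHb (ltnW bs); have IH2 := IHa b.+1 (ltnW ar) bs.
have IH3 := IHa b (ltnW ar) (ltnW bs).
rewrite !addnS !addSn in IH1 IH2 IH3 *.
transitivity ((X + 1) * (X ^+ (a + b).+2 * T a.+2 b.+1 + X ^+ (a + b).+2 * T a.+1 b.+2
                         - X * (X ^+ (a + b).+1 * T a.+1 b.+1))).
  by rewrite !exprS; field.
by rewrite IH1 IH2 IH3 !exprS; field.
Qed.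
End Evaluations.

(** * Cells as chains *)

Section Cells.
Implicit Types c : seq ('I_r * 'I_s).

Lemma le2_anti : antisymmetric le2.
Proof.
move=> [i j] [i' j']; rewrite /le2 /= => /andP[/andP[h1 h2] /andP[h3 h4]].
by congr (_, _); apply/val_inj/eqP; rewrite eqn_leq; apply/andP.
Qed.

Lemma le2_trans : transitive le2.
Proof.
move=> y x z /andP[h1 h2] /andP[h3 h4].
by rewrite /le2 (leq_trans h1 h3) (leq_trans h2 h4).
Qed.

Lemma is_cellE c : is_cell c = uniq c && sorted le2 c.
Proof. by []. Qed.

Lemma rows_cell c : rows [set x in c] = Sx c.
Proof.
by apply/setP => i; apply/imsetP/imsetP => -[x xc ->]; exists x;
  rewrite ?inE // in xc *.
Qed.

Lemma cols_cell c : cols [set x in c] = Sy c.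
Proof.
by apply/setP => i; apply/imsetP/imsetP => -[x xc ->]; exists x;
  rewrite ?inE // in xc *.
Qed.

Lemma card_cell c : is_cell c -> #|[set x in c]| = size c.
Proof. by rewrite is_cellE cardsE => /andP[/card_uniqP]. Qed.

(** The order is antisymmetric, so a set of pairs has only one sorted listing without repetition. *)
Lemma cell_eq c c' :
  is_cell c -> is_cell c' -> [set x in c] = [set x in c'] -> c = c'.
Proof.
rewrite !is_cellE => /andP[uc sc] /andP[uc' sc'] /setP e.
apply: (sorted_eq le2_trans le2_anti) => //; apply: uniq_perm => // x.
by have := e x; rewrite !inE.
Qed.

Lemma chain_cell c : is_cell c -> chain [set x in c].
Proof.
rewrite is_cellE => /andP[_]; rewrite (sorted_pairwise le2_trans) => sc.
apply/chainP => a b; rewrite !inE.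
elim: c sc => //= x c IH /andP[/allP xc /IH{}IH]; rewrite !inE.
case/predU1P=> [->|ac] /predU1P[->|bc]; last exact: IH.
- by rewrite /le2 !leqnn.
- by rewrite xc.
- by rewrite xc ?orbT.
Qed.

Lemma cell_of_chain S : chain S -> exists2 c, is_cell c & S = [set x in c].
Proof.
move=> /chainP cS; exists (sort le2 (enum S)); last first.
  by apply/setP => x; rewrite inE mem_sort mem_enum.
rewrite is_cellE sort_uniq enum_uniq /=.
by apply: (sort_sorted_in cS); apply/allP => x; rewrite mem_enum.
Qed.

Lemma size_cell c : is_cell c -> c != [::] -> (size c < #|Sx c| + #|Sy c|)%N.
Proof.
have SxU x c' : Sx (x :: c') = x.1 |: Sx c'.
  by rewrite -!rows_cell -imsetU1 set_cons.
have SyU x c' : Sy (x :: c') = x.2 |: Sy c'.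
  by rewrite -!cols_cell -imsetU1 set_cons.
elim: c => // x [|y c] IH.
  by rewrite -rows_cell -cols_cell set_cons set_nil setU0 /rows /cols !imset_set1 !cards1.
rewrite is_cellE (sorted_pairwise le2_trans) => /andP[uc pc] _.
have /IH/(_ isT) lt : is_cell (y :: c).
  rewrite is_cellE (sorted_pairwise le2_trans).
  by case/andP: uc pc => _ uc /andP[_ pc]; apply/andP.
(* If both coordinates of x recurred later, the next pair y would be above x with coordinates at
   most those of x, so y = x, against uniqueness. *)
have new : (x.1 \notin Sx (y :: c)) || (x.2 \notin Sy (y :: c)).
  rewrite -negb_and; apply/negP => /andP[/imsetP[a ac ax] /imsetP[b bc bx]].
  case/andP: uc => /negP[]; case/andP: pc => /allP xle pc.
  suff -> : x = y by rewrite mem_head.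
  have ley z : z \in y :: c -> le2 y z.
    rewrite inE => /predU1P[->|zc]; first by rewrite /le2 !leqnn.
    by case/andP: pc => /allP /(_ _ zc).
  apply: le2_anti; rewrite xle ?mem_head // /le2 ax bx.
  by have /andP[-> _] := ley _ ac; have /andP[_ ->] := ley _ bc.
rewrite SxU SyU !cardsU1 /=; move: new lt => /=.
by case: (_ \notin _); case: (_ \notin _) => // _;
  rewrite /= ?add0n ?add1n ?addSn ?addnS !ltnS // => /ltnW.
Qed.

(** Passes from cells listed by length to sets of pairs; lengths up to r * s suffice because the
    pairs are distinct. *)
Lemma sum_cells (R : fieldType) (K : nat -> {set 'I_r} -> {set 'I_s} -> bool)
    (f : nat -> {set 'I_r} -> {set 'I_s} -> R) :
  \sum_(l < (r * s).+1) \sum_(c : l.-tuple ('I_r * 'I_s) |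
      is_cell c && K l (Sx c) (Sy c)) f l (Sx c) (Sy c)
  = \sum_(S | chain S && K #|S| (rows S) (cols S)) f #|S| (rows S) (cols S).
Proof.
have le_card S : (#|S| < (r * s).+1)%N.
  by rewrite ltnS (leq_trans (max_card _)) // card_prod !card_ord.
rewrite [RHS](partition_big (fun S => Ordinal (le_card S)) xpredT) //=.
apply: eq_bigr => l _.
pose g (c : l.-tuple ('I_r * 'I_s)) := [set x in c].
pose A := [pred c : l.-tuple ('I_r * 'I_s) | is_cell c && K l (Sx c) (Sy c)].
pose fS S := f #|S| (rows S) (cols S).
transitivity (\sum_(c in A) fS (g c)).
  apply: eq_bigr => c /andP[cc _].
  by rewrite /fS /g rows_cell cols_cell card_cell // size_tuple.
rewrite -(big_imset fS) /=; last first.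
  move=> c c' /andP[cc _] /andP[cc' _] e; apply: val_inj; exact: cell_eq.
apply: eq_bigl => S; apply/imsetP/andP.
  move=> [c /andP[cc Kc] ->]; rewrite -val_eqE /=.
  by rewrite /g rows_cell cols_cell card_cell // size_tuple chain_cell // Kc.
move=> [/andP[/cell_of_chain[c cc ->]]]; rewrite -val_eqE /= card_cell //.
rewrite rows_cell cols_cell => Kc /eqP sc.
have sc' : size c == l by apply/eqP.
by exists (Tuple sc'); rewrite // inE /= cc -sc Kc.
Qed.

End Cells.
End ChainSets.

(** * Character sums *)

Section Characters.
Variables (F : finFieldType) (psi w : F -> algC).
Hypothesis psi_nt : nontrivial_add_char psi.
Hypothesis w_gen : is_char_generator w.
Local Notation X := #|F|.-1.

Lemma card_field_gt1 : (1 < #|F|)%N.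
Proof. exact: finNzRing_gt1. Qed.

Lemma pred_card_gt0 : (0 < X)%N.
Proof. by have := card_field_gt1; case: #|F| => [|[]]. Qed.

Lemma natr_pred_card : X%:R = #|F|%:R - 1 :> algC.
Proof. by rewrite -{2}(prednK (ltnW card_field_gt1)) -natr1 addrK. Qed.

Lemma card_nonzero : #|[pred x : F | x != 0]| = X.
Proof. by rewrite (eq_card (B := predC1 0)) // cardC1. Qed.

Lemma sum_nonzero1 : \sum_(x : F | x != 0) 1 = X%:R :> algC.
Proof. by rewrite sumr_const card_nonzero. Qed.

Lemma reindex_nonzero (R : nmodType) (f : F -> R) (a : F) : a != 0 ->
  \sum_(x | x != 0) f x = \sum_(x | x != 0) f (a * x).
Proof.
move=> a0; rewrite (reindex ( *%R a)) /=; last first.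
  by exists ( *%R a^-1) => x _; rewrite ?mulKf ?mulVKf.
by apply: eq_bigl => x; rewrite mulf_eq0 (negPf a0).
Qed.

Lemma expf_pred_card (x : F) : x != 0 -> x ^+ X = 1.
Proof.
move=> x0; apply: (mulfI x0); rewrite -exprS prednK ?expf_card ?mulr1 //.
exact: ltnW card_field_gt1.
Qed.

Lemma add_char0 : psi 0 = 1. Proof. by case: psi_nt => -[]. Qed.
Lemma add_charD x y : psi (x + y) = psi x * psi y. Proof. by case: psi_nt => -[]. Qed.

Lemma add_char_sum (I : finType) (P : pred I) (f : I -> F) :
  psi (\sum_(i | P i) f i) = \prod_(i | P i) psi (f i).
Proof. exact: (big_morph _ add_charD add_char0). Qed.

Lemma sum_add_char : \sum_x psi x = 0.
Proof.
have [_ [a pa]] := psi_nt.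
have : \sum_x psi x = psi a * \sum_x psi x.
  rewrite {1}(reindex (+%R a)) /= ?mulr_sumr; last first.
    by exists (+%R (- a)) => x _; rewrite ?addKr ?addNKr.
  by apply: eq_bigr => x _; rewrite add_charD.
move/eqP; rewrite -subr_eq0 -{1}[\sum_x _]mul1r -mulrBl mulf_eq0 subr_eq0.
by rewrite eq_sym (negPf pa) => /eqP.
Qed.

Lemma sum_add_char_mul x : \sum_u psi (u * x) = if x == 0 then #|F|%:R else 0.
Proof.
case: eqP => [->|/eqP x0].
  under eq_bigr do rewrite mulr0 add_char0.
  by rewrite sumr_const.
rewrite -[RHS]sum_add_char [RHS](reindex ( *%R^~ x)) //=.
by exists ( *%R^~ x^-1) => y _; rewrite ?mulfK ?mulfVK.
Qed.

Lemma mult_char1 : w 1 = 1. Proof. by case: w_gen => -[]. Qed.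

Lemma mult_charM x y : x != 0 -> y != 0 -> w (x * y) = w x * w y.
Proof. by case: w_gen => -[_ h] _; apply: h. Qed.

Lemma mult_char_neq0 x : x != 0 -> w x != 0.
Proof.
move=> x0; apply: contraTneq (oner_neq0 algC) => wx0.
by rewrite -mult_char1 -(divff x0) mult_charM ?invr_eq0 // wx0 mul0r eqxx.
Qed.

Lemma mult_charX x n : x != 0 -> w (x ^+ n) = w x ^+ n.
Proof.
move=> x0; elim: n => [|n IH]; first by rewrite !expr0 mult_char1.
by rewrite !exprS mult_charM ?expf_neq0 // IH.
Qed.

Lemma mult_charV x : x != 0 -> w x^-1 = (w x)^-1.
Proof.
move=> x0; apply: (mulfI (mult_char_neq0 x0)).
by rewrite -mult_charM ?invr_eq0 // !divff ?mult_char1 ?mult_char_neq0.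
Qed.

Lemma mult_char_prod (I : finType) (P : pred I) (f : I -> F) :
  (forall i, P i -> f i != 0) ->
  w (\prod_(i | P i) f i) = \prod_(i | P i) w (f i).
Proof.
move=> f0; suff [] : w (\prod_(i | P i) f i) = \prod_(i | P i) w (f i)
   /\ \prod_(i | P i) f i != 0 by [].
elim/big_rec2: _ => [|i y x Pi [<- x0]]; first by rewrite mult_char1 oner_neq0.
by rewrite mult_charM ?f0 // mulf_neq0 ?f0.
Qed.

Lemma mult_char_pred_card x : x != 0 -> w x ^+ X = 1.
Proof. by move=> x0; rewrite -mult_charX // expf_pred_card // mult_char1. Qed.

Lemma mult_char_pow_dvd x (k : int) : x != 0 -> (X %| `|k|)%N -> w x ^ k = 1.
Proof.
move=> x0 /dvdnP[n e]; have := mult_char_pred_card x0 => h.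
have e1 : w x ^+ (n * X) = 1 by rewrite mulnC exprM h expr1n.
case: k e => k /= e; first by rewrite -[LHS]/(w x ^+ k) e e1.
by rewrite -[LHS]/((w x ^+ k.+1)^-1) e e1 invr1.
Qed.

(** If X does not divide k, the order of the generator provides a with w(a)^k different from 1, and
    substituting a x for x multiplies the sum by w(a)^k. *)
Lemma sum_mult_char_pow (k : int) :
  \sum_(x | x != 0) w x ^ k = if (X %| `|k|)%N then X%:R else 0.
Proof.
case: ifP => dk.
  by rewrite -sum_nonzero1; apply: eq_bigr => x x0; rewrite mult_char_pow_dvd.
have [a a0 wa] : exists2 a, a != 0 & w a ^ k != 1.
  have [_ gen] := w_gen.
  case: (boolP [exists a, (a != 0) && (w a ^ k != 1)]) => [/existsP[a /andP[]]|].
    by exists a.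
  move=> /existsPn h; move: dk; rewrite gen // => x x0.
  have /eqP := h x; rewrite x0 /= negbK => /eqP/eqP.
  by case: k {h} => k //= h; apply: invr_inj; rewrite invr1.
have : \sum_(x | x != 0) w x ^ k = w a ^ k * \sum_(x | x != 0) w x ^ k.
  rewrite {1}(reindex_nonzero _ a0) mulr_sumr; apply: eq_bigr => x x0.
  by rewrite mult_charM // expfzMl.
move/eqP; rewrite -subr_eq0 -{1}[\sum_(x | _) _]mul1r -mulrBl mulf_eq0 subr_eq0.
by rewrite eq_sym (negPf wa) => /eqP.
Qed.

(** Write x = g^n with g a generator of the unit group. For every y = g^l, w(y)^n = w(x)^l = 1, so X
    divides n because w has order X. *)
Lemma mult_char_inj x : x != 0 -> w x = 1 -> x = 1.
Proof.
move=> x0 wx1; have [_ gen] := w_gen.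
have /cyclicP[g eg] := field_unit_group_cyclic [set: {unit F}]%G.
have unit_pow y : y != 0 -> exists n, y = FinRing.uval g ^+ n.
  rewrite -unitfE => uy.
  have : FinRing.unit F uy \in <[g]>%g by rewrite -eg inE.
  by case/cycleP=> n en; exists n; rewrite -FinRing.val_unitX -en.
have g0 : FinRing.uval g != 0 by rewrite -unitfE; case: (g).
have [n xn] := unit_pow _ x0.
have /dvdnP[k nk] : (X %| n)%N.
  apply: gen => y y0; have [l ->] := unit_pow _ y0.
  by rewrite mult_charX // exprAC -mult_charX // -xn wx1 expr1n.
by rewrite xn nk mulnC exprM expf_pred_card // expr1n.
Qed.

Lemma sum_pow_mult_char x : x != 0 -> \sum_(m < X) w x ^+ m = if x == 1 then X%:R else 0.
Proof.
move=> x0; case: eqP => [->|/eqP x1].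
  under eq_bigr do rewrite mult_char1 expr1n.
  by rewrite sumr_const card_ord.
have wx1 : w x != 1 by apply: contra x1 => /eqP/(mult_char_inj x0)/eqP.
apply/eqP; have := subrX1 (w x) X; rewrite mult_char_pred_card // subrr => /esym/eqP.
by rewrite mulf_eq0 subr_eq0 (negPf wx1).
Qed.

(** The twist u is the dual variable of the linear equation; u = 0 is allowed and gives the main
    term of the counts. *)
Definition gauss_at (u : F) (k : int) : algC :=
  \sum_(x | x != 0) w x ^ k * psi (u * x).

Lemma gauss_at0 k : gauss_at 0 k = if (X %| `|k|)%N then X%:R else 0.
Proof.
by rewrite -sum_mult_char_pow; apply: eq_bigr => x _; rewrite mul0r add_char0 mulr1.
Qed.

Lemma gauss_atE u k : u != 0 -> gauss_at u k = w u ^ (- k) * gauss psi w k.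
Proof.
move=> u0; have u0' : u^-1 != 0 by rewrite invr_eq0.
rewrite /gauss_at (reindex_nonzero _ u0') mulr_sumr; apply: eq_bigr => x x0.
by rewrite mulVKf // mult_charM // mult_charV // expfzMl -mulrA exprz_inv.
Qed.

(** The character w^k is trivial and psi sums to 0 over the whole field, so the nonzero x contribute
    - psi 0. *)
Lemma gauss_dvd k : (X %| `|k|)%N -> gauss psi w k = -1.
Proof.
move=> dk; rewrite /gauss.
transitivity (\sum_(x | x != 0) psi x).
  by apply: eq_bigr => x x0; rewrite mult_char_pow_dvd // mul1r.
apply/eqP; rewrite -subr_eq0 opprK -add_char0 addrC; apply/eqP; rewrite -[RHS]sum_add_char.
by rewrite [RHS](bigD1 0).
Qed.

End Characters.

(** * Points of the tori *)

Section Scaling.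
Variables (F : finFieldType) (T : finType) (act : F -> T -> T) (coord : T -> F).
Variable S : {set T}.
Hypothesis act1 : forall t, act 1 t = t.
Hypothesis actM : forall (u v : F) t, u != 0 -> v != 0 -> act u (act v t) = act (u * v) t.
Hypothesis coord_act : forall (u : F) t, u != 0 -> coord (act u t) = u * coord t.
Hypothesis actS : forall (u : F) t, u != 0 -> t \in S -> act u t \in S.
Hypothesis coord_neq0 : forall t, t \in S -> coord t != 0.

(** Each t arises in exactly one way from an element of coordinate 1, by the scalar [coord t]. *)
Lemma card_scaling : #|S| = (#|F|.-1 * #|[set t in S | coord t == 1%R]|)%N.
Proof.
set S1 := [set t in S | coord t == 1].
have <- : #|[set~ (0 : F)]| = #|F|.-1 by rewrite cardsC1.
rewrite -cardsX -(card_in_imset (f := fun ut => act ut.1 ut.2)).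
  apply: eq_card => t; apply/idP/imsetP => [tS|[[u t']]].
    have c0 := coord_neq0 tS; have c0' : (coord t)^-1 != 0 by rewrite invr_eq0.
    exists (coord t, act (coord t)^-1 t) => /=; last by rewrite actM // divff.
    by rewrite !inE /= c0 actS // coord_act // mulVf ?eqxx.
  by rewrite !inE /= => /and3P[u0 t'S _] ->; apply: actS.
move=> [u t] [u' t']; rewrite !inE /= => /and3P[u0 tS /eqP ct] /and3P[u0' tS' /eqP ct'] e.
have := congr1 coord e; rewrite !coord_act // ct ct' !mulr1 => eu.
rewrite -eu in e u0' *; congr (_, _).
by rewrite -[t]act1 -[t']act1 -(mulVf u0) -!actM ?invr_eq0 // e.
Qed.

End Scaling.

Section Counting.
Variables (F : finFieldType) (r s : nat) (p : 'I_r -> nat) (q : 'I_s -> nat).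
Variables (psi w : F -> algC) (lam : F).
Hypothesis psi_nt : nontrivial_add_char psi.
Hypothesis w_gen : is_char_generator w.
Hypothesis lam_neq0 : lam != 0.
Hypothesis sum_pq : (\sum_(i < r) p i = \sum_(j < s) q j)%N.
Hypothesis gcd_pq : gcdn (\big[gcdn/0%N]_(i < r) p i) (\big[gcdn/0%N]_(j < s) q j) = 1%N.
Local Notation X := #|F|.-1.
Implicit Types (A : {set 'I_r}) (B : {set 'I_s}) (u : F) (m a : nat).
Local Notation point := ({ffun 'I_r -> F} * {ffun 'I_s -> F} * F)%type.

Definition vanish_exactly n (A : {set 'I_n}) (x : {ffun 'I_n -> F}) :=
  [forall i, if i \in A then x i == 0 else x i != 0].

(** The set counted by [Nprime] before one coordinate is normalised to 1. For A and B empty and a =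
    0, z is free and (x, y) runs over the affine cone of V. *)
Definition torus_set (A : {set 'I_r}) (B : {set 'I_s}) (a : nat) : {set point} :=
  [set t : point | [&& vanish_exactly A t.1.1, vanish_exactly B t.1.2, t.2 != 0,
     \sum_(i | i \notin A) t.1.1 i == \sum_(j | j \notin B) t.1.2 j &
     lam * t.2 ^+ a * \prod_(i | i \notin A) t.1.1 i ^+ p i
       == \prod_(j | j \notin B) t.1.2 j ^+ q j]].

(** The zero pattern is built into the factor, so that a sum over all points splits coordinate by
    coordinate. *)
Definition xfactor A u m (i : 'I_r) (x : F) : algC :=
  if i \in A then (x == 0)%:R
  else (x != 0)%:R * (w x ^ (p i * m)%N * psi (u * x)).
Definition yfactor B u m (j : 'I_s) (y : F) : algC :=
  if j \in B then (y == 0)%:R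
  else (y != 0)%:R * (w y ^ (- (q j * m)%N%:Z) * psi (- u * y)).

Lemma sum_xfactor A u m i : \sum_x xfactor A u m i x =
  if i \in A then 1 else gauss_at psi w u (p i * m)%N.
Proof.
rewrite /xfactor; case: ifP => _.
  by rewrite (bigD1 0) //= eqxx big1 ?addr0 // => x /negPf->.
rewrite /gauss_at [RHS]big_mkcond; apply: eq_bigr => x _.
by case: eqP => _; rewrite ?mul0r ?mul1r.
Qed.

Lemma sum_yfactor B u m j : \sum_y yfactor B u m j y =
  if j \in B then 1 else gauss_at psi w (- u) (- (q j * m)%N%:Z).
Proof.
rewrite /yfactor; case: ifP => _.
  by rewrite (bigD1 0) //= eqxx big1 ?addr0 // => x /negPf->.
rewrite /gauss_at [RHS]big_mkcond; apply: eq_bigr => x _.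
by case: eqP => _; rewrite ?mul0r ?mul1r.
Qed.

Lemma prod_xfactor0 A u m (x : {ffun 'I_r -> F}) :
  ~~ vanish_exactly A x -> \prod_i xfactor A u m i (x i) = 0.
Proof.
rewrite negb_forall => /existsP[i]; rewrite (bigD1 i) //= /xfactor.
by case: ifP => _; [move=> /negPf-> | rewrite negbK => ->]; rewrite !mul0r.
Qed.

Lemma prod_yfactor0 B u m (y : {ffun 'I_s -> F}) :
  ~~ vanish_exactly B y -> \prod_j yfactor B u m j (y j) = 0.
Proof.
rewrite negb_forall => /existsP[i]; rewrite (bigD1 i) //= /yfactor.
by case: ifP => _; [move=> /negPf-> | rewrite negbK => ->]; rewrite !mul0r.
Qed.

Lemma vanish_neq0 n (A : {set 'I_n}) x i :
  vanish_exactly A x -> i \notin A -> x i != 0.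
Proof. by move=> /forallP/(_ i); case: (i \in A). Qed.

Lemma prod_xfactor A u m (x : {ffun 'I_r -> F}) : vanish_exactly A x ->
  \prod_i xfactor A u m i (x i) =
  w (\prod_(i | i \notin A) x i ^+ p i) ^+ m * psi (u * \sum_(i | i \notin A) x i).
Proof.
move=> vx; rewrite mulr_sumr (add_char_sum psi_nt) (mult_char_prod w_gen) => [|i iA]; last first.
  by rewrite expf_neq0 // (vanish_neq0 vx).
rewrite -prodrXl -big_split [RHS]big_mkcond /=; apply: eq_bigr => i _.
have := forallP vx i; rewrite /xfactor; case: ifP => /= _ => [->//|x0].
by rewrite x0 mul1r (mult_charX w_gen) // -exprM.
Qed.

Lemma prod_yfactor B u m (y : {ffun 'I_s -> F}) : vanish_exactly B y ->
  \prod_j yfactor B u m j (y j) =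
  w (\prod_(j | j \notin B) y j ^+ q j)^-1 ^+ m * psi (- u * \sum_(j | j \notin B) y j).
Proof.
move=> vy; rewrite mulr_sumr (add_char_sum psi_nt).
have y0 j : j \notin B -> y j ^+ q j != 0.
  by move=> jB; rewrite expf_neq0 // (vanish_neq0 vy).
rewrite (mult_charV w_gen) ?prodf_seq_neq0 ?(mult_char_prod w_gen) //; last first.
  by apply/allP => j _; apply/implyP/y0.
rewrite -prodfV -prodrXl -big_split [RHS]big_mkcond /=; apply: eq_bigr => i _.
have := forallP vy i; rewrite /yfactor; case: ifP => /= _ => [->//|x0].
by rewrite x0 mul1r (mult_charX w_gen) // exprVn -exprM -exprnN.
Qed.

(* Detecting the two equations by additive and multiplicative characters. *)
Lemma card_torus_set A B a :
  #|F|%:R * X%:R * #|torus_set A B a|%:R =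
  \sum_u \sum_(m < X) w lam ^+ m * (\sum_(z | z != 0) w z ^ (a * m)%N)
    * \prod_i (if i \in A then 1 else gauss_at psi w u (p i * m)%N)
    * \prod_j (if j \in B then 1 else gauss_at psi w (- u) (- (q j * m)%N%:Z)).
Proof.
pose term u m (t : point) := w lam ^+ m * ((t.2 != 0)%:R * w t.2 ^ (a * m)%N)
   * \prod_i xfactor A u m i (t.1.1 i) * \prod_j yfactor B u m j (t.1.2 j).
transitivity (\sum_u \sum_(m < X) \sum_t term u m t); last first.
  apply: eq_bigr => u _; apply: eq_bigr => m _.
  under [X in _ = _ * X * _]eq_bigr do rewrite -sum_xfactor.
  under [X in _ = _ * X]eq_bigr do rewrite -sum_yfactor.
  have sum_triple (I J K : finType) (f : I -> algC) (g : J -> algC) (h : K -> algC) :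
      (\sum_i f i) * (\sum_j g j) * (\sum_k h k)
      = \sum_(t : I * J * K) f t.1.1 * g t.1.2 * h t.2.
    by rewrite big_distrlr /= pair_big /= big_distrlr pair_big.
  have comb (c z x y : algC) : c * z * x * y = c * (x * y * z) by ring.
  rewrite !bigA_distr_bigA comb [\sum_(z | z != 0) _]big_mkcond sum_triple mulr_sumr.
  apply: eq_bigr => t _; rewrite /term -comb.
  by case: (t.2 != 0); rewrite ?mul1r ?mul0r.
under eq_bigr do rewrite exchange_big.
rewrite exchange_big /= -[#|torus_set A B a|]sum1_card natr_sum mulr_sumr [LHS]big_mkcond.
apply: eq_bigr => -[[x y] z] _; rewrite /term inE /=.
case: (boolP (vanish_exactly A x)) => vx /=; last first.
  by rewrite big1 // => u _; rewrite big1 // => m _; rewrite prod_xfactor0 // mulr0 mul0r.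
case: (boolP (vanish_exactly B y)) => vy /=; last first.
  by rewrite big1 // => u _; rewrite big1 // => m _; rewrite prod_yfactor0 // mulr0.
case: (boolP (z != 0)) => z0 /=; last first.
  by rewrite big1 // => u _; rewrite big1 // => m _; rewrite mul0r mulr0 !mul0r.
set sx := \sum_(i | _) _; set sy := \sum_(i | _) _.
set px := \prod_(i | _) _; set py := \prod_(i | _) _.
have px0 : px != 0.
  by apply/prodf_neq0 => i iA; rewrite expf_neq0 // (vanish_neq0 vx).
have py0 : py != 0.
  by apply/prodf_neq0 => i iB; rewrite expf_neq0 // (vanish_neq0 vy).
(* At a point with the right zero pattern, the sum over u detects the linear equation and the sum
   over m the monomial one. *)
transitivity ((\sum_u psi (u * (sx - sy))) *
              \sum_(m < X) w (lam * z ^+ a * px * py^-1) ^+ m).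
  rewrite (sum_add_char_mul psi_nt) (sum_pow_mult_char w_gen) ?mulf_neq0 ?invr_eq0 ?expf_neq0 //.
  rewrite subr_eq0 -[_ / py == 1](inj_eq (mulIf py0)) mulfVK // mul1r.
  by case: eqP; case: eqP; rewrite ?mulr0 ?mul0r ?mulr1.
rewrite big_distrlr /=; apply: eq_bigr => u _; apply: eq_bigr => m _.
rewrite prod_xfactor // prod_yfactor // -/sx -/sy -/px -/py.
rewrite mulrBr -mulNr (add_charD psi_nt).
rewrite !(mult_charM w_gen) ?mulf_neq0 ?invr_eq0 ?expf_neq0 //.
rewrite (mult_charX w_gen) // !exprMn -exprM -exprnP; ring.
Qed.

Definition gcd_on A B : nat :=
  gcdn (\big[gcdn/0%N]_(i in A) p i) (\big[gcdn/0%N]_(j in B) q j).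

Lemma gcd_onP A B d : (d %| gcd_on A B)%N =
  [forall i in A, (d %| p i)%N] && [forall j in B, (d %| q j)%N].
Proof.
rewrite dvdn_gcd; congr (_ && _); apply/dvdn_biggcdP/forall_inP => h i; exact: h.
Qed.

(* The weight of z under which the product equation, whose x- and y-degrees differ
   once the coordinates in A and B are removed, is homogeneous. *)
Definition scaling_weight A B : int :=
  ((\sum_(i in A) p i) %/ gcd_on A B)%N%:Z - ((\sum_(j in B) q j) %/ gcd_on A B)%N%:Z.

Lemma scaling_weightE A B : (gcd_on A B)%:Z * scaling_weight A B =
  (\sum_(i in A) p i)%N%:Z - (\sum_(j in B) q j)%N%:Z.
Proof.
have : (gcd_on A B %| gcd_on A B)%N by [].
rewrite gcd_onP => /andP[/forall_inP dA /forall_inP dB].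
rewrite mulrBr -!PoszM ![(gcd_on A B * _)%N]mulnC !divnK //; exact: dvdn_sum.
Qed.

Definition scale A B (u : F) (t : point) : point :=
  ([ffun i => u * t.1.1 i], [ffun j => u * t.1.2 j], u ^ scaling_weight A B * t.2).

Lemma scale1 A B t : scale A B 1 t = t.
Proof.
case: t => -[x y] z; rewrite /scale exp1rz mul1r; congr (_, _, _).
  by apply/ffunP => i; rewrite ffunE mul1r.
by apply/ffunP => i; rewrite ffunE mul1r.
Qed.

Lemma scaleM A B u v t : u != 0 -> v != 0 ->
  scale A B u (scale A B v t) = scale A B (u * v) t.
Proof.
move=> u0 v0; case: t => -[x y] z; rewrite /scale /= expfzMl mulrA; congr (_, _, _).
  by apply/ffunP => i; rewrite !ffunE mulrA.
by apply/ffunP => i; rewrite !ffunE mulrA.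
Qed.

Lemma vanish_scale n (A : {set 'I_n}) u (x : {ffun 'I_n -> F}) : u != 0 ->
  vanish_exactly A x -> vanish_exactly A [ffun i => u * x i].
Proof.
move=> u0 /forallP vx; apply/forallP => i; have := vx i; rewrite ffunE.
by rewrite mulf_eq0 (negPf u0).
Qed.

(** The two monomials are scaled by u to their degrees outside A and B; since the total degrees
    agree, the power of z supplies exactly the difference. *)
Lemma scale_torus A B u t : u != 0 ->
  t \in torus_set A B (gcd_on A B) -> scale A B u t \in torus_set A B (gcd_on A B).
Proof.
move=> u0; case: t => -[x y] z; rewrite !inE /= => /and5P[vx vy z0 /eqP es /eqP ep].
rewrite !vanish_scale //= mulf_neq0 ?expfz_neq0 //=; apply/andP; split.
  under eq_bigr do rewrite ffunE.
  under [X in _ == X]eq_bigr do rewrite ffunE.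
  by rewrite -!mulr_sumr es.
under eq_bigr do rewrite ffunE exprMn.
under [X in _ == X]eq_bigr do rewrite ffunE exprMn.
rewrite !big_split /= -ep !prodrXr exprMn.
have -> : (u ^ scaling_weight A B) ^+ gcd_on A B =
    u ^ ((\sum_(i in A) p i)%N%:Z - (\sum_(j in B) q j)%N%:Z).
  by rewrite -scaling_weightE mulrC exprnP exprz_exp.
set a := (\sum_(i in A) p i)%N; set b := (\sum_(j in B) q j)%N.
have eab : u ^ (a%:Z - b%:Z) * u ^+ (\sum_(i | i \notin A) p i)%N =
    u ^+ (\sum_(j | j \notin B) q j)%N.
  rewrite !exprnP -expfzDr //; congr (u ^ _).
  have := sum_pq; rewrite (bigID (mem A)) [in RHS](bigID (mem B)) /= -/a -/b.
  move: a b (\sum_(i | i \notin A) p i)%N (\sum_(j | j \notin B) q j)%N => a b c d; clear; lia.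
by rewrite -eab; apply/eqP; ring.
Qed.

Lemma card_torus_coord A B (k : 'I_r + 'I_s) :
  (match k with inl i => i \notin A | inr j => j \notin B end) ->
  #|torus_set A B (gcd_on A B)| = (X * #|[set t in torus_set A B (gcd_on A B) |
     (match k with inl i => t.1.1 i | inr j => t.1.2 j end) == 1%R]|)%N.
Proof.
move=> hk; apply: (@card_scaling _ _ (scale A B)
  (fun t : point => match k with inl i => t.1.1 i | inr j => t.1.2 j end)).
- exact: scale1.
- by move=> u v t u0 v0; apply: scaleM.
- by move=> u t u0; case: k {hk} => i /=; rewrite ffunE.
- by move=> u t u0; apply: scale_torus.
by case: k hk => i hi t; rewrite inE => /and5P[vx vy _ _ _]; apply: vanish_neq0 hi.
Qed.

Lemma card_torus_Nprime (c : seq ('I_r * 'I_s)) : (#|Sx c| + #|Sy c| < r + s)%N ->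
  #|torus_set (Sx c) (Sy c) (gcd_on (Sx c) (Sy c))| = (X * Nprime p q lam c)%N.
Proof.
move=> lt; rewrite /Nprime; case: pickP => [i iA|nA].
  rewrite (@card_torus_coord _ _ (inl i)) //; congr (_ * _)%N.
  apply: eq_card => t; rewrite !inE; rewrite -!andbA; do !bool_congr.
case: pickP => [j jB|nB].
  rewrite (@card_torus_coord _ _ (inr j)) //; congr (_ * _)%N.
  apply: eq_card => t; rewrite !inE; rewrite -!andbA; do !bool_congr.
move: lt; have full n (A : {set 'I_n}) : (fun i => i \notin A) =1 xpred0 -> #|A| = n.
  move=> h; rewrite -[RHS]card_ord; apply: eq_card => i; rewrite !inE.
  by apply/negbFE/h.
by rewrite !full // ltnn.
Qed.

(** One factor X comes from normalising x_1, the other from z, which is free because the gcd of the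
    empty family is 0. *)
Lemma card_torus_Vcount (r_gt0 : (0 < r)%N) :
  #|torus_set set0 set0 (gcd_on set0 set0)| = (X * (X * Vcount p q lam))%N.
Proof.
rewrite (@card_torus_coord _ _ (inl (Ordinal r_gt0))) ?inE //; congr (_ * _)%N.
have <- : #|[set~ (0 : F)]| = X by rewrite cardsC1.
rewrite mulnC -cardsX; apply: eq_card => -[[x y] z]; rewrite !inE /=.
have all0 n (f : {ffun 'I_n -> F}) : vanish_exactly set0 f = [forall i, f i != 0].
  by apply: eq_forallb => i; rewrite inE.
have -> : [forall i : 'I_r, (val i == 0)%N ==> (x i == 1)] = (x (Ordinal r_gt0) == 1).
  apply/forallP/eqP => [/(_ (Ordinal r_gt0))/eqP //|h i].
  by apply/implyP => /eqP i0; rewrite -h; apply/eqP; congr (x _); apply: val_inj.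
have -> : gcd_on set0 set0 = 0%N by rewrite /gcd_on !big_set0.
rewrite !all0 expr0 mulr1.
have nset0 n : (fun i : 'I_n => i \notin set0) =1 xpredT by move=> i; rewrite inE.
rewrite !(eq_bigl _ _ (@nset0 _)).
by rewrite -!andbA; do !bool_congr.
Qed.

(** These are the m that survive the sum over z, by [dvdn_gcd_on]. *)
Definition adm A B m : bool :=
  [forall i in A, (X %| p i * m)%N] && [forall j in B, (X %| q j * m)%N].

Definition gauss_term m : algC :=
  w ((-1) ^+ (\sum_(j < s) q j) * lam) ^+ m
  * (\prod_(i < r) gauss psi w (p i * m)%N)
  * (\prod_(j < s) gauss psi w (- (q j * m)%N%:Z)).

Lemma dvdn_gcd_on A B m : (X %| gcd_on A B * m)%N = adm A B m.
Proof.
have mulg n (C : {set 'I_n}) (f : 'I_n -> nat) :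
    ((\big[gcdn/0]_(i in C) f i) * m)%N = \big[gcdn/0%N]_(i in C) (f i * m)%N.
  exact: (big_morph (muln^~ m) (fun a b => muln_gcdl a b m) (mul0n m)).
rewrite /gcd_on muln_gcdl !mulg dvdn_gcd; congr (_ && _);
by apply/dvdn_biggcdP/forall_inP => h i; exact: h.
Qed.

Lemma adm_full m : (m < X)%N -> adm setT setT m = (m == 0)%N.
Proof.
move=> mX; rewrite -dvdn_gcd_on.
have -> : gcd_on setT setT = 1%N.
  rewrite -gcd_pq /gcd_on; congr gcdn; apply: eq_bigl => i; exact: in_setT.
rewrite mul1n; case: m mX => [|m] mX; first by rewrite dvdn0.
by apply/negP => /(dvdn_leq (ltn0Sn m)); rewrite leqNgt mX.
Qed.

Lemma gauss_term0 : gauss_term 0 = (-1) ^+ (r + s).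
Proof.
rewrite /gauss_term expr0 mul1r exprD; congr (_ * _).
  rewrite -[in RHS](card_ord r) -prodr_const; apply: eq_bigr => i _.
  by rewrite muln0 (gauss_dvd psi_nt w_gen).
rewrite -[in RHS](card_ord s) -prodr_const; apply: eq_bigr => i _.
by rewrite muln0 (gauss_dvd psi_nt w_gen).
Qed.

(** At u = 0 each present coordinate forces its own divisibility by X, and the sum over z forces
    those on A and B. Together they leave only m = 0, where z and each present coordinate contribute
    X. *)
Lemma torus_term0 A B m : (m < X)%N ->
  w lam ^+ m * (\sum_(z | z != 0) w z ^ (gcd_on A B * m)%N)
    * \prod_i (if i \in A then 1 else gauss_at psi w 0 (p i * m)%N)
    * \prod_j (if j \in B then 1 else gauss_at psi w (- 0) (- (q j * m)%N%:Z))
  = if (m == 0)%N then X%:R ^+ (1 + #|~: A| + #|~: B|) else 0.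
Proof.
move=> mX; rewrite oppr0 (sum_mult_char_pow w_gen) /= dvdn_gcd_on -adm_full //.
case: (boolP (adm setT setT m)) => [aT|].
  have m0 : m = 0%N by move: aT; rewrite adm_full // => /eqP.
  rewrite m0; have -> : adm A B 0.
    by apply/andP; split; apply/forall_inP => i _; rewrite muln0 dvdn0.
  rewrite expr0 mul1r !exprD expr1 -!prodr_const; congr (_ * _ * _).
    rewrite [RHS]big_mkcond; apply: eq_bigr => i _; rewrite inE.
    by case: (i \in A) => //=; rewrite gauss_at0 // muln0 ?oppr0 dvdn0.
  rewrite [RHS]big_mkcond; apply: eq_bigr => i _; rewrite inE.
  by case: (i \in B) => //=; rewrite gauss_at0 // muln0 ?oppr0 dvdn0.
case: ifP => [/andP[/forall_inP aA /forall_inP aB]|_ _]; last first.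
  by rewrite mulr0 !mul0r.
rewrite negb_and => /orP[] /forall_inPn[i _ ni].
  rewrite (bigD1 i) //=; case: ifP => [/aA|_]; first by rewrite (negPf ni).
  by rewrite gauss_at0 //= (negPf ni) mul0r mulr0 mul0r.
rewrite [X in _ * X](bigD1 i) //=; case: ifP => [/aB|_]; first by rewrite (negPf ni).
by rewrite gauss_at0 // abszN /= (negPf ni) mul0r mulr0.
Qed.

(** The Gauss sums release w(u)^(-m sum p) and w(-u)^(m sum q). As the degrees agree, only w(-1)^(m
    sum q) remains, which is the sign epsilon. On A and B the factor 1 is rewritten as -1 times a
    Gauss sum equal to -1. *)
Lemma torus_term_neq0 A B m u : u != 0 ->
  w lam ^+ m * (\sum_(z | z != 0) w z ^ (gcd_on A B * m)%N)
    * \prod_i (if i \in A then 1 else gauss_at psi w u (p i * m)%N)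
    * \prod_j (if j \in B then 1 else gauss_at psi w (- u) (- (q j * m)%N%:Z))
  = if adm A B m then X%:R * (-1) ^+ (#|A| + #|B|) * gauss_term m else 0.
Proof.
move=> u0; rewrite (sum_mult_char_pow w_gen) /= dvdn_gcd_on; case: ifP => [|_]; last first.
  by rewrite mulr0 !mul0r.
case/andP=> /forall_inP aA /forall_inP aB.
have Nu0 : - u != 0 by rewrite oppr_eq0.
have -> : \prod_i (if i \in A then 1 else gauss_at psi w u (p i * m)%N)
   = w u ^- (m * \sum_i p i) * (-1) ^+ #|A| * \prod_i gauss psi w (p i * m)%N.
  have -> : w u ^- (m * \sum_i p i) = \prod_i w u ^ (- (p i * m)%N%:Z).
    rewrite -exprVn big_distrr /= -prodrXr; apply: eq_bigr => i _.
    by rewrite mulnC exprVn exprnN.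
  rewrite -prodr_const [\prod_(i in A) _]big_mkcond -!big_split /=.
  apply: eq_bigr => i _; case: ifP => [/aA d|_].
    by rewrite (gauss_dvd psi_nt w_gen) // (mult_char_pow_dvd w_gen) ?abszN // !mul1r mulrN1 opprK.
  by rewrite mulr1 gauss_atE.
have -> : \prod_j (if j \in B then 1 else gauss_at psi w (- u) (- (q j * m)%N%:Z))
   = w (- u) ^+ (m * \sum_j q j) * (-1) ^+ #|B| * \prod_j gauss psi w (- (q j * m)%N%:Z).
  have -> : w (- u) ^+ (m * \sum_j q j) = \prod_j w (- u) ^ (q j * m)%N.
    by rewrite big_distrr /= -prodrXr; apply: eq_bigr => i _; rewrite mulnC.
  rewrite -prodr_const [\prod_(i in B) _]big_mkcond -!big_split /=.
  apply: eq_bigr => i _; case: ifP => [/aB d|_].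
    by rewrite (gauss_dvd psi_nt w_gen) ?abszN // (mult_char_pow_dvd w_gen) // !mul1r mulrN1 opprK.
  by rewrite mulr1 gauss_atE // opprK.
have N1 : (-1 : F) != 0 by rewrite oppr_eq0 oner_eq0.
rewrite /gauss_term -[- u]mulN1r !(mult_charM w_gen) ?expf_neq0 // (mult_charX w_gen) // sum_pq.
rewrite exprD [(w _ * w _) ^+ (m * _)]exprMn [(w _ ^+ _ * _) ^+ _]exprMn -exprM [(_ * m)%N]mulnC.
have := mult_char_neq0 w_gen u0; move: (w u) => wu wu0; field.
by rewrite expf_neq0.
Qed.

(** The first term is u = 0; the X nonzero values of u contribute equally. *)
Lemma card_torus_set_gcd A B :
  #|F|%:R * X%:R * #|torus_set A B (gcd_on A B)|%:R
  = X%:R ^+ (1 + #|~: A| + #|~: B|)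
    + X%:R ^+ 2 * (-1) ^+ (#|A| + #|B|) * \sum_(m < X | adm A B m) gauss_term m.
Proof.
rewrite card_torus_set (bigD1 0) //=; congr (_ + _).
  under eq_bigr => m _ do rewrite torus_term0 //.
  by rewrite (bigD1 (Ordinal (pred_card_gt0 F))) //= big1 ?addr0 // => -[[|m] mX].
transitivity (\sum_(u : F | u != 0) (X%:R * (-1) ^+ (#|A| + #|B|) *
   \sum_(m < X | adm A B m) gauss_term m)).
  apply: eq_bigr => u u0; rewrite mulr_sumr [RHS]big_mkcond.
  by apply: eq_bigr => m _; rewrite torus_term_neq0.
by rewrite sumr_const card_nonzero -mulr_natr; ring.
Qed.

End Counting.

(** * Contributions of the cells *)

Section Totals.
Variables (R : fieldType) (r s : nat) (X : R).
Hypothesis X_neq0 : X != 0.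

Lemma chain_sum_total (u u' : 'I_r -> R) (v v' : 'I_s -> R) :
  chain_sum X u u' v v' r s =
  \sum_(S : {set 'I_r * 'I_s} | chain S) X ^- #|S|
     * (\prod_i (if i \in rows S then u i else u' i))
     * (\prod_j (if j \in cols S then v j else v' j)).
Proof.
apply: eq_big => S; last first.
  by move=> _; congr (_ * _ * _); apply: eq_bigl => i; rewrite ltn_ord.
by rewrite (_ : box _ _ _) ?andbT //; apply/forall_inP => x _; rewrite !ltn_ord.
Qed.

Lemma prod_indicator n (A : {set 'I_n}) (x y : R) :
  \prod_i (if i \in A then x else y) = x ^+ #|A| * y ^+ #|~: A|.
Proof.
rewrite -!prodr_const [\prod_(i in A) _]big_mkcond [\prod_(i in ~: A) _]big_mkcond.
rewrite -big_split /=; apply: eq_bigr => i _; rewrite inE.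
by case: (i \in A); rewrite ?mulr1 ?mul1r.
Qed.

Lemma chain_sum_total1 :
  @chain_sum r s R X (fun=> 1) (fun=> 1) (fun=> 1) (fun=> 1) r s =
  \sum_(S : {set 'I_r * 'I_s} | chain S) X ^- #|S|.
Proof.
rewrite chain_sum_total; apply: eq_bigr => S _.
by rewrite !prod_indicator !expr1n !mulr1.
Qed.

Lemma chain_sum_total_full :
  @chain_sum r s R X (fun=> 1) (fun=> 0) (fun=> 1) (fun=> 0) r s =
  \sum_(S : {set 'I_r * 'I_s} | chain S && ((rows S == setT) && (cols S == setT))) X ^- #|S|.
Proof.
have T n (A : {set 'I_n}) : (A == setT) = (#|~: A| == 0%N).
  by rewrite cards_eq0 -setCT (inj_eq (@setC_inj _)).
rewrite chain_sum_total [RHS]big_mkcondr; apply: eq_bigr => S _.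
rewrite !prod_indicator !expr1n !mul1r !T !expr0n.
by case: eqP; case: eqP; rewrite ?mulr1 ?mulr0.
Qed.

Lemma chain_sum_total_signed (I : {set 'I_r}) (J : {set 'I_s}) :
  \sum_(S : {set 'I_r * 'I_s} | chain S && ((rows S \subset I) && (cols S \subset J)))
     (- X) ^+ (#|rows S| + #|cols S|) / X ^+ #|S|
  = (X + 1) ^+ minn #|I| #|J|.
Proof.
rewrite -[in RHS](prefix_card_full I) -[in RHS](prefix_card_full J).
rewrite -(chain_sum_signed X_neq0) // chain_sum_total big_mkcondr.
apply: eq_bigr => S _.
have sub n (A K : {set 'I_n}) :
  \prod_i (if i \in A then (if i \in K then - X else 0) else 1) =
  if A \subset K then (- X) ^+ #|A| else 0.
  case: ifP => [/subsetP AK|/negbT/subsetPn[i iA niK]]; last first.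
    by rewrite (bigD1 i) //= iA (negPf niK) mul0r.
  rewrite -prodr_const [RHS]big_mkcond; apply: eq_bigr => i _.
  by case: ifP => // /AK ->.
rewrite !sub exprD; case: (rows S \subset I); last by rewrite mulr0 mul0r.
by case: (cols S \subset J); rewrite ?mulr0 // mulrC mulrA.
Qed.

End Totals.

(** The two halves of each numerator of [Prs] give one Delannoy polynomial each, after writing
    Q^(a+b-m) = Q^(a+b) Q^-m with Q = X + 1. *)
Lemma PrsE a b (X : algC) : X != 0 -> X + 1 != 0 ->
  Prs a.+1 b.+1 (X + 1)
  = ((X + 1) ^+ (a + b) * delannoy (X + 1)^-1 a b - delannoy (X + 1) a b) / X.
Proof.
move=> X0 Q0; rewrite /Prs !subn1 /=.
rewrite -!(@delannoy_widen algC _ a b (minn a b)) // mulr_sumr -sumrB mulr_suml.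
apply: eq_bigr => -[m /= lem] _; rewrite addrK.
have -> : (a.+1 + b.+1 - m - 2 = a + b - m)%N by lia.
have -> : (X + 1) ^+ (a + b) = (X + 1) ^+ (a + b - m) * (X + 1) ^+ m.
  by rewrite -exprD subnK //; lia.
rewrite exprVn; move: ('C(a, m) * 'C(b, m))%N => k.
have : (X + 1) ^+ m != 0 by rewrite expf_neq0.
move: ((X + 1) ^+ m) ((X + 1) ^+ (a + b - m)) k%:R => x y z x0; field.
by rewrite X0.
Qed.

(** * Summation over all cells and comparison with the hypergeometric sum *)

Section Assembly.
Variables (F : finFieldType) (r s : nat) (p : 'I_r -> nat) (q : 'I_s -> nat).
Variables (psi w : F -> algC) (lam : F).
Hypothesis psi_nt : nontrivial_add_char psi.
Hypothesis w_gen : is_char_generator w.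
Hypothesis lam_neq0 : lam != 0.
Hypothesis sum_pq : (\sum_(i < r) p i = \sum_(j < s) q j)%N.
Hypothesis gcd_pq : gcdn (\big[gcdn/0%N]_(i < r) p i) (\big[gcdn/0%N]_(j < s) q j) = 1%N.
Hypothesis r_gt0 : (0 < r)%N.
Hypothesis s_gt0 : (0 < s)%N.
Implicit Types (A : {set 'I_r}) (B : {set 'I_s}) (S : {set 'I_r * 'I_s}) (m l : nat).
Local Notation X := (#|F|.-1%:R : algC).
Local Notation Q := (X + 1).
Local Notation G := (gauss_term p q psi w lam).

Let X_neq0 : X != 0. Proof. by rewrite pnatr_eq0 -lt0n pred_card_gt0. Qed.

Lemma natr_card : #|F|%:R = Q. Proof. by rewrite natr_pred_card subrK. Qed.

Let Q_neq0 : Q != 0.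
Proof. by rewrite -natr_card pnatr_eq0 -lt0n (ltnW (card_field_gt1 F)). Qed.

Definition adm_sum A B : algC := \sum_(m < #|F|.-1 | adm F p q A B m) G m.

(** The exponent |S| - l - 1 is written with divisions, so that it may equal -1 for the empty cell,
    where the formula gives [Vcount]. *)
Definition contribution l A B : algC :=
  X ^+ (#|A| + #|B|) / X ^+ l / X / Q
  * (X ^+ (#|~: A| + #|~: B|) / X + (-1) ^+ (#|A| + #|B|) * adm_sum A B).

Lemma torus_setE A B :
  #|torus_set p q lam A B (gcd_on p q A B)|%:R =
  X * ((X ^+ (#|~: A| + #|~: B|) / X + (-1) ^+ (#|A| + #|B|) * adm_sum A B) / Q).
Proof.
have := card_torus_set_gcd psi_nt w_gen lam_neq0 sum_pq gcd_pq A B.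
rewrite -/(adm_sum A B) natr_card -addnA exprD expr1 => e.
by apply: (mulfI (mulf_neq0 Q_neq0 X_neq0)); rewrite e; field; rewrite X_neq0 Q_neq0.
Qed.

Lemma Vcount_contribution : (Vcount p q lam)%:R = contribution 0 set0 set0.
Proof.
have := torus_setE set0 set0.
rewrite (card_torus_Vcount _ sum_pq r_gt0) !natrM mulrA => e.
apply: (mulfI (mulf_neq0 X_neq0 X_neq0)); rewrite e /contribution !cards0 !expr0.
by field; rewrite X_neq0 Q_neq0.
Qed.

Lemma Ncell_contribution (c : seq ('I_r * 'I_s)) : is_cell c -> c != [::] ->
  (#|Sx c| + #|Sy c| < r + s)%N ->
  (Ncell p q lam c)%:R = contribution (size c) (Sx c) (Sy c).
Proof.
move=> cc c0 lt; have := torus_setE (Sx c) (Sy c).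
rewrite (card_torus_Nprime _ sum_pq lt) natrM.
move=> /(mulfI X_neq0) e; rewrite /Ncell natrM e natrX /contribution mulrA.
have -> : X ^+ (#|Sx c| + #|Sy c|) =
    X ^+ (#|Sx c| + #|Sy c| - size c - 1) * X ^+ size c * X.
  by rewrite -exprD -exprSr; congr (_ ^+ _); have := size_cell cc c0; lia.
by field; rewrite X_neq0 Q_neq0 expf_neq0.
Qed.

Lemma dvdn_missing d n (f : 'I_n -> nat) (C : {set 'I_n}) :
  (d %| \sum_i f i)%N -> (#|~: C| <= 1)%N -> (forall i, i \in C -> d %| f i)%N ->
  forall i, (d %| f i)%N.
Proof.
move=> dsum C1 dC i; case: (boolP (i \in C)) => [/dC //|iC].
move: dsum; rewrite (bigD1 i) //= dvdn_addl //; apply: dvdn_sum => k ki; apply: dC.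
apply: contraNT ki => kC; apply/eqP.
by apply: (card_le1_eqP C1); rewrite inE.
Qed.

(** At most one coordinate lies outside A and B, so one side is complete and its sum is divisible by
    X. Equality of the degrees makes the sum on the other side divisible too, hence also its one
    missing term. *)
Lemma adm_corank1 A B m : (r + s - 1 <= #|A| + #|B|)%N ->
  adm F p q A B m -> adm F p q setT setT m.
Proof.
have := cardsC A; have := cardsC B; rewrite !card_ord => cB cA le.
case/andP=> /forall_inP dA /forall_inP dB.
have sumE : (\sum_i p i * m = \sum_j q j * m)%N by rewrite -!big_distrl /= sum_pq.
have A1 : (#|~: A| <= 1)%N by lia.
have B1 : (#|~: B| <= 1)%N by lia.
have [A0|B0] : #|~: A| = 0%N \/ #|~: B| = 0%N by lia.
  have dp i : (#|F|.-1 %| p i * m)%N.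
    by apply: dA; move/eqP: A0; rewrite cards_eq0 -setCT => /eqP/setC_inj->; rewrite inE.
  apply/andP; split; apply/forall_inP => i _ //.
  by apply: (dvdn_missing _ B1 dB); rewrite -sumE; apply: dvdn_sum.
have dq j : (#|F|.-1 %| q j * m)%N.
  by apply: dB; move/eqP: B0; rewrite cards_eq0 -setCT => /eqP/setC_inj->; rewrite inE.
apply/andP; split; apply/forall_inP => i _ //.
by apply: (dvdn_missing _ A1 dA); rewrite sumE; apply: dvdn_sum.
Qed.

Lemma adm_sum_corank1 A B : (r + s - 1 <= #|A| + #|B|)%N ->
  adm_sum A B = (-1) ^+ (r + s).
Proof.
move=> le; rewrite -(gauss_term0 p q lam psi_nt w_gen) /adm_sum.
rewrite (big_pred1 (Ordinal (pred_card_gt0 F))) // => m.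
rewrite /= -val_eqE /= -(@adm_full F _ _ _ _ gcd_pq) //.
apply/idP/idP; first exact: adm_corank1.
by case/andP=> /forall_inP a /forall_inP b; apply/andP; split;
  apply/forall_inP => i _; rewrite ?a ?b ?inE.
Qed.

(** The main term is X / X = 1, and the character sum contributes (-1)^(r+s-1) (-1)^(r+s) = -1. *)
Lemma contribution_corank1 l A B : (#|A| + #|B|)%N = (r + s - 1)%N ->
  contribution l A B = 0.
Proof.
move=> e; rewrite /contribution adm_sum_corank1 ?e //.
have -> : (#|~: A| + #|~: B|)%N = 1%N.
  by have := cardsC A; have := cardsC B; rewrite !card_ord; lia.
have -> : (r + s = (r + s - 1).+1)%N by lia.
rewrite subn1 /= expr1 divff // exprS mulrCA -expr2 sqrr_sign mulr1.
by rewrite addrN mulr0.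
Qed.

Lemma contribution_full l :
  contribution l setT setT = X ^+ (r + s) / X ^+ 2 / X ^+ l.
Proof.
rewrite /contribution adm_sum_corank1 !cardsT !card_ord ?leq_subr //.
rewrite !setCT !cards0 expr0 -expr2 sqrr_sign.
by field; rewrite X_neq0 expf_neq0.
Qed.

Lemma admE A B m : adm F p q A B m =
  (A \subset [set i | (p i * m %% #|F|.-1 == 0)%N]) &&
  (B \subset [set j | (q j * m %% #|F|.-1 == 0)%N]).
Proof.
by congr (_ && _); apply/forall_inP/subsetP => h i /h; rewrite inE.
Qed.

(** The main terms give the chain sum with trivial weights. For the others, exchange the sums: for
    fixed m the chains allowed are those with rows and columns among the indices counted by [sfun],
    and their signed sum is Q^s(m). *)
Lemma sum_contribution :
  \sum_(S | chain S) contribution #|S| (rows S) (cols S)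
  = X ^+ (r + s) / X ^+ 2 / Q * \sum_(S : {set 'I_r * 'I_s} | chain S) X ^- #|S|
    + \sum_(m < #|F|.-1) G m * Q ^+ sfun F p q m / (X * Q).
Proof.
have contributionE S : contribution #|S| (rows S) (cols S) =
    X ^+ (r + s) / X ^+ 2 / Q * X ^- #|S| +
    \sum_(m < #|F|.-1) (if adm F p q (rows S) (cols S) m then
       G m / (X * Q) * ((- X) ^+ (#|rows S| + #|cols S|) / X ^+ #|S|) else 0).
  rewrite -big_mkcond -mulr_suml -mulr_suml -/(adm_sum _ _) /contribution.
  have -> : X ^+ (r + s) = X ^+ (#|rows S| + #|cols S|) * X ^+ (#|~: rows S| + #|~: cols S|).
    rewrite -exprD; congr (_ ^+ _).
    by have := cardsC (rows S); have := cardsC (cols S); rewrite !card_ord; lia.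
  rewrite [(- X) ^+ _]exprNn.
  by field; rewrite X_neq0 Q_neq0 expf_neq0.
rewrite (eq_bigr _ (fun S _ => contributionE S)) big_split -mulr_sumr /=; congr (_ + _).
rewrite exchange_big; apply: eq_bigr => m _ /=.
rewrite -big_mkcondr -mulr_sumr [RHS]mulrAC; congr (_ * _).
under eq_bigl => S do rewrite admE.
exact: chain_sum_total_signed.
Qed.

(** The empty chain gives V and the small cells give the N_C. Of the remaining chains, those missing
    exactly one row or column contribute 0, and those with full support are subtracted. *)
Lemma count_contribution :
  (Vcount p q lam)%:R +
    \sum_(l < (r * s).+1)
      \sum_(c : l.-tuple ('I_r * 'I_s) |
              [&& is_cell c, (0 < l)%N & (#|Sx c| + #|Sy c| <= r + s - 2)%N])
        (Ncell p q lam c)%:R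
  = \sum_(S | chain S) contribution #|S| (rows S) (cols S)
    - \sum_(S : {set 'I_r * 'I_s} | chain S && ((rows S == setT) && (cols S == setT)))
        X ^+ (r + s) / X ^+ 2 / X ^+ #|S|.
Proof.
pose K l A B := (0 < l)%N && (#|A| + #|B| <= r + s - 2)%N.
have -> : \sum_(l < (r * s).+1)
      \sum_(c : l.-tuple ('I_r * 'I_s) |
              [&& is_cell c, (0 < l)%N & (#|Sx c| + #|Sy c| <= r + s - 2)%N])
        (Ncell p q lam c)%:R
   = \sum_(S | chain S && K #|S| (rows S) (cols S)) contribution #|S| (rows S) (cols S).
  rewrite -(sum_cells K contribution); apply: eq_bigr => l _; apply: eq_bigr => c.
  case/and3P => cc l0 le; rewrite Ncell_contribution ?size_tuple //; last by lia.
  by rewrite -size_eq0 size_tuple -lt0n.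
rewrite Vcount_contribution.
have rows0 : @rows r s set0 = set0 by exact: imset0.
have cols0 : @cols r s set0 = set0 by exact: imset0.
rewrite [\sum_(S | chain S) _](bigD1 set0) /=; last first.
  by apply/chainP => a b; rewrite inE.
rewrite cards0 rows0 cols0 -addrA; congr (_ + _); apply/eqP; rewrite eq_sym subr_eq; apply/eqP.
rewrite (bigID (fun S => (#|rows S| + #|cols S| <= r + s - 2)%N)) /=; congr (_ + _).
  by apply: eq_bigl => S; rewrite /K card_gt0 -andbA.
rewrite big_mkcond [RHS]big_mkcond; apply: eq_bigr => S _.
have fullE : (rows S == setT) && (cols S == setT) = (r + s <= #|rows S| + #|cols S|)%N.
  rewrite !eqEcard !subsetT !cardsT !card_ord /=.
  have le n (A : {set 'I_n}) : (#|A| <= n)%N by rewrite -[leqRHS]card_ord max_card.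
  have := le _ (rows S); have := le _ (cols S).
  by move: #|rows S| #|cols S| => a b; lia.
case: (boolP (chain S)) => //= _.
have -> : (S != set0) && ~~ (#|rows S| + #|cols S| <= r + s - 2)%N =
    (r + s - 1 <= #|rows S| + #|cols S|)%N.
  have [->|_] /= := eqVneq S set0; rewrite ?rows0 ?cols0 ?cards0; lia.
case: (boolP (_ && _)) => [/andP[/eqP rT /eqP cT]|].
  by rewrite rT cT contribution_full cardsT cardsT !card_ord leq_subr.
rewrite fullE -ltnNge => lt; case: leqP => // le; apply: contribution_corank1; lia.
Qed.

(** M is nonzero in F by the condition on the characteristic, so it cancels in the argument of
    omega; the signs combine with 1 - q to give 1 / X. *)
Lemma HqE : (forall ch, ch \in [pchar F] ->
     (forall i, ~~ (ch %| p i)%N) /\ (forall j, ~~ (ch %| q j)%N)) ->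
  (-1) ^+ (r + s - 1) * (#|F|%:R : algC) ^+ minn (r - 1) (s - 1)
      * Hq p q psi w (Mconst F p q * lam)
   = \sum_(m < #|F|.-1) G m * Q ^+ sfun F p q m / (X * Q).
Proof.
move=> charF; have [ch _ chF] := finPcharP F; have [np nq] := charF _ chF.
have M0 : Mconst F p q != 0.
  rewrite mulf_neq0 ?invr_eq0 //; apply/prodf_neq0 => i _; rewrite expf_neq0 //.
    by rewrite -(dvdn_pcharf chF).
  by rewrite -(dvdn_pcharf chF).
(* At m = 0 every index counts, so s(0) = min(r, s). This exceeds the exponent of q in front by one
   and leaves a single Q in the denominator. *)
have sfun0 : sfun F p q 0 = (minn (r - 1) (s - 1)).+1.
  have full n (f : 'I_n -> nat) : #|[set i | (f i * 0 %% #|F|.-1 == 0)%N]| = n.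
    by rewrite -[RHS]card_ord; apply: eq_card => i; rewrite inE muln0 mod0n.
  by rewrite /sfun !full; lia.
have rs : (-1) ^+ (r + s) = - (-1) ^+ (r + s - 1) :> algC.
  by rewrite -[in LHS](prednK (ltn_addr s r_gt0)) subn1 exprS mulN1r.
rewrite /Hq 2!mulr_sumr; apply: eq_bigr => m _.
rewrite [epsF F q / _ * _]mulrA divfK // sfun0 natr_card expfzDr // -exprnN -[Q ^ _]/(Q ^+ _).
rewrite /gauss_term /epsF rs [Q ^+ _.+1]exprS.
have N0 : - X != 0 by rewrite oppr_eq0.
have -> : 1 - Q = - X by rewrite opprD addrCA subrr addr0.
have := sqrr_sign algC (r + s - 1); rewrite expr2.
move: ((-1) ^+ _) => e ee; set c := minn _ _.
have : Q ^+ c != 0 by rewrite expf_neq0.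
move: (Q ^+ c) (Q ^+ sfun F p q m) => y z y0.
move: (w _ ^+ m) (\prod_i _) (\prod_j _) => a b d.
transitivity (e * e * (a * d * b * z / (X * Q))); last by rewrite ee mul1r.
by field; rewrite X_neq0 Q_neq0 y0.
Qed.

End Assembly.

Theorem mainTheorem1 (F : finFieldType) (r s : nat)
  (p : 'I_r -> nat) (q : 'I_s -> nat) (psi omega : F -> algC) (lam : F) :
  (0 < r)%N -> (0 < s)%N ->
  (forall i, 0 < p i)%N -> (forall j, 0 < q j)%N ->
  (\sum_(i < r) p i = \sum_(j < s) q j)%N ->
  gcdn (\big[gcdn/0%N]_(i < r) p i) (\big[gcdn/0%N]_(j < s) q j) = 1%N ->
  (forall ch, ch \in [pchar F] ->
     (forall i, ~~ (ch %| p i)%N) /\ (forall j, ~~ (ch %| q j)%N)) ->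
  nontrivial_add_char psi -> is_char_generator omega ->
  lam != 0 ->
  (Vcount p q lam)%:R +
    \sum_(l < (r * s).+1)
      \sum_(c : l.-tuple ('I_r * 'I_s) |
              [&& is_cell c, (0 < l)%N & (#|Sx c| + #|Sy c| <= r + s - 2)%N])
        (Ncell p q lam c)%:R
  = Prs r s #|F|%:R
    + (-1) ^+ (r + s - 1) * (#|F|%:R : algC) ^+ minn (r - 1) (s - 1)
      * Hq p q psi omega (Mconst F p q * lam).

Proof.
move=> r_gt0 s_gt0 _ _ sum_pq gcd_pq charF psi_nt w_gen lam_neq0.
rewrite (count_contribution psi_nt w_gen lam_neq0) // sum_contribution // HqE //.
rewrite addrAC; congr (_ + _).
rewrite -mulr_sumr -chain_sum_total1 -chain_sum_total_full natr_card.
have X0 : #|F|.-1%:R != 0 :> algC by rewrite pnatr_eq0 -lt0n pred_card_gt0.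
have Q0 : #|F|.-1%:R + 1 != 0 :> algC.
  by rewrite -natr_card pnatr_eq0 -lt0n (ltnW (card_field_gt1 F)).
(* What remains is an identity between the two chain sums and P_rs, valid for any X with X and X + 1
   nonzero. *)
clear -r_gt0 s_gt0 X0 Q0; move: #|F|.-1%:R X0 Q0 => X X0 Q0.
case: r r_gt0 => // a _; case: s s_gt0 => // b _.
rewrite PrsE //.
have all := @chain_sum_all a.+1 b.+1 _ X X0 a b (ltnSn a) (ltnSn b) Q0.
have full := @chain_sum_full a.+1 b.+1 _ X X0 a b (ltnSn a) (ltnSn b).
rewrite addSn addnS -full mulrBl; congr (_ - _); last by rewrite !exprS; field.
have -> : (X + 1) ^+ (a + b) * delannoy (X + 1)^-1 a b =
   (X + 1) ^+ (a + b).+1 * delannoy (X + 1)^-1 a b / (X + 1) by rewrite exprS; field.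
by rewrite -all !exprS; field; rewrite X0.
Qed.
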